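(* Let $N\ge 9$ and let $u^*$ be the extremal solution of $(P)_\lambda$ in the unit ball $B\subset\mathbb{R}^N$. Then $u^*(x)\le 1-|x|^{4/3}$ in $B$.
   Context: $B$ is the open unit ball in $\mathbb{R}^N$ and $\partial_\nu$ is the outward normal derivative on $\partial B$. For $\lambda>0$, problem $(P)_\lambda$ is $$\Delta^2 u=\frac{\lambda}{(1-u)^2}\ \text{in } B,\qquad 0<u<1\ \text{in } B,\qquad u=\partial_\nu u=0\ \text{on }\partial B.$$ Define $\lambda^*:=\sup\{\lambda>0:\ (P)_\lambda \text{ has a classical solution}\}$; it is known that $0<\lambda^*<\infty$. For each $0<\lambda<\lambda^*$ there is (known) a classical minimal solution $u_\lambda$ of $(P)_\lambda$, i.e. one lying below every other classical solution; it is radial and radially decreasing, and $\lambda\mapsto u_\lambda(x)$ is strictly increasing on $(0,\lambda^* )$ for each $x\in B$. The extremal solution is the pointwise limit $u^*(x):=\lim_{\lambda\nearrow\lambda^*}u_\lambda(x)$. *)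

(* Defs.v *)
From HB Require Import structures.
From mathcomp Require Import all_boot all_order all_algebra.
From mathcomp Require Import all_classical all_reals all_analysis.
Set Implicit Arguments.
Unset Strict Implicit.
Unset Printing Implicit Defensive.
Import Order.TTheory GRing.Theory Num.Theory.
Import numFieldNormedType.Exports.
Local Open Scope classical_set_scope.
Local Open Scope ring_scope.

Section Space.
Context {R : realType} {N : nat}.
Implicit Types (u v : 'rV[R]_N -> R) (x : 'rV[R]_N).

(* The library norm on 'rV[R]_N is the sup norm: it gives the right topology,
   but not the Euclidean ball. *)
Definition enorm x : R := Num.sqrt (\sum_(i < N) x 0 i ^+ 2).

Definition uball : set 'rV[R]_N := [set x | enorm x < 1].
Definition ucball : set 'rV[R]_N := [set x | enorm x <= 1].
Definition usphere : set 'rV[R]_N := [set x | enorm x = 1].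

Definition partial (i : 'I_N) u : 'rV[R]_N -> R := 'D_(delta_mx 0 i) u.

Definition iter_partial (s : seq 'I_N) u : 'rV[R]_N -> R := foldr partial u s.

Definition laplacian u : 'rV[R]_N -> R :=
  fun x => \sum_(i < N) partial i (partial i u) x.

Definition bilaplacian u : 'rV[R]_N -> R := laplacian (laplacian u).

(* 'D_v is total, so the existence of the partial derivatives of order at most
   k has to be required separately from their continuity. *)
Definition Ck_ball (k : nat) u : Prop :=
  forall x, uball x -> forall s : seq 'I_N,
    ((size s <= k)%N -> {for x, continuous (iter_partial s u)}) /\
    ((size s < k)%N -> forall i : 'I_N,
      derivable (iter_partial s u) x (delta_mx 0 i)).

Definition C1_cball u : Prop :=
  [/\ Ck_ball 1 u,
      {within ucball, continuous u} &
      forall i : 'I_N, exists2 g : 'rV[R]_N -> R,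
        {within ucball, continuous g} &
        forall x, uball x -> g x = partial i u x].

(* Functions are total on R^N but only their values on the closed ball are
   meaningful, so the derivative along the outward unit normal (which is x
   itself at x on the sphere) is taken from inside the ball: h < 0. *)
Definition has_normal_derivative u x (l : R) : Prop :=
  h^-1 * (u (x + h *: x) - u x) @[h --> 0^'-] --> l.

Definition classical_solution (lam : R) u : Prop :=
  [/\ Ck_ball 4 u /\ C1_cball u,
      forall x, uball x -> bilaplacian u x = lam / (1 - u x) ^+ 2,
      forall x, uball x -> 0 < u x < 1 &
      forall x, usphere x -> u x = 0 /\ has_normal_derivative u x 0].

Definition minimal_solution (lam : R) u : Prop :=
  classical_solution lam u /\
  forall v, classical_solution lam v -> forall x, uball x -> u x <= v x.

End Space.

Section Extremal.
Variables (R : realType) (N : nat).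

Definition lambda_star : \bar R :=
  ereal_sup [set lam%:E | lam in [set lam : R |
    0 < lam /\ exists u : 'rV[R]_N -> R, classical_solution lam u]].

(* Meant for 0 < lambda_star < +oo, where fine lambda_star is lambda_star
   itself. A minimal solution is unique on the ball, so the choice of the family
   u does not affect ustar there. *)
Definition extremal_solution (ustar : 'rV[R]_N -> R) : Prop :=
  exists u : R -> 'rV[R]_N -> R,
    (forall lam : R, 0 < lam -> (lam%:E < lambda_star)%E ->
       minimal_solution lam (u lam)) /\
    (forall x, uball x ->
       u lam x @[lam --> (fine lambda_star)^'-] --> ustar x).

End Extremal.

(* Main.v *)
Require Import Defs.
From mathcomp Require Import all_boot all_order all_algebra.
From mathcomp Require Import all_classical all_reals all_analysis.
From mathcomp Require Import ring lra.
Set Implicit Arguments.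
Unset Strict Implicit.
Unset Printing Implicit Defensive.
Import Order.TTheory GRing.Theory Num.Theory.
Import numFieldNormedType.Exports.
Local Open Scope classical_set_scope.
Local Open Scope ring_scope.

(** The barrier [1 - |x|^(4/3)] solves the equation outside the origin for the
parameter [barrier_const = (8/9) (N - 2/3) (N - 8/3)]. It is shown that the minimal
solution [u] for _every_ [lam] below [lambda_star] lies below the barrier; the
extremal solution inherits the bound as a pointwise limit.

Minimal solutions are radial, since composing with a reflection gives another
classical solution ([minimal_solution_radial]). So everything reduces to profiles
in [r = |x|], that is to ordinary differential equations ([classical_profile]).
The two cases use opposite properties of the barrier.

If [lam >= barrier_const], convexity of [1 / (1 - u)^2] shows that the difference
[W = barrier - u] satisfies [r^4 Laplacian^2 W <= k W] with [k = 2 barrier_const].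
For [N >= 9], [k] is below the Hardy-Rellich constant [N^2 (N - 4)^2 / 16], so that
[r^4 Laplacian^2 - k] factors into four real Euler operators [r d/dr - al], three of
them with [al < 0]. Each such factor can be inverted with a sign for functions
that are bounded at 0; what remains says that [W] divided by a power of [r] is
nonincreasing, and as [W] vanishes at 1 it is nonnegative
([hardy_rellich_comparison]). This replaces the usual argument with quadratic
forms in the energy space.

If [lam <= barrier_const], the barrier is a supersolution. A solution below both
the barrier and [u] is found as a fixed point of the radial solution operator,
which is order preserving by a radial version of Boggio's principle
([radial_boggio], [exists_solution_below]). It is a classical solution on the
ball, because the profile is smooth as a function of [r^2]
([lift_classical_solution]). Minimality puts [u] below it, hence below the
barrier. *)

(** * Derivatives and one-sided limits of real functions *)

Section RealFunctions.
Context {R : realType}.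
Implicit Types (f g df dg : R -> R) (x a b l : R).

Lemma is_derive1_continuous f x a : is_derive x 1 f a -> {for x, continuous f}.
Proof.
move=> [df _]; apply: differentiable_continuous; exact/derivable1_diffP.
Qed.

Lemma is_derive1_eq f x a b : a = b -> is_derive x 1 f a -> is_derive x 1 f b.
Proof. by move=> ->. Qed.

Lemma is_derive1_id x : is_derive x 1 (fun y : R => y) 1.
Proof. exact: is_derive_id. Qed.

Lemma is_derive1_cst k x : is_derive x 1 (fun _ : R => k : R) 0.
Proof. exact: is_derive_cst. Qed.

Lemma is_derive1_add f g x a b : is_derive x 1 f a -> is_derive x 1 g b ->
  is_derive x 1 (fun y => f y + g y) (a + b).
Proof. by move=> fa gb; exact: is_deriveD. Qed.

Lemma is_derive1_sub f g x a b : is_derive x 1 f a -> is_derive x 1 g b ->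
  is_derive x 1 (fun y => f y - g y) (a - b).
Proof. by move=> fa gb; exact: is_deriveB. Qed.

Lemma is_derive1_mul f g x a b : is_derive x 1 f a -> is_derive x 1 g b ->
  is_derive x 1 (fun y => f y * g y) (a * g x + f x * b).
Proof.
move=> fa gb; apply: is_derive_eq (is_deriveM fa gb) _.
by rewrite /GRing.scale /= addrC (mulrC a).
Qed.

Lemma is_derive1_cmul f k x a : is_derive x 1 f a ->
  is_derive x 1 (fun y => k * f y) (k * a).
Proof. by move=> fa; exact: is_deriveZ. Qed.

Lemma is_derive1_exprn n x :
  is_derive x 1 (fun y : R => y ^+ n) (n%:R * x ^+ n.-1).
Proof.
have h := is_deriveX n (is_derive_id x (1 : R)).
have -> : (fun y : R => y ^+ n) = id ^+ n by apply/funext => y; rewrite exprfctE.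
by apply: (is_derive_eq h); exact: mulr1.
Qed.

Lemma is_derive1_inv f x a : f x != 0 -> is_derive x 1 f a ->
  is_derive x 1 (fun y => (f y)^-1) (- a / f x ^+ 2).
Proof.
move=> fx0 fa; apply: is_derive_eq (is_deriveV fx0 fa) _.
by rewrite /GRing.scale /= mulNr mulNr mulrC.
Qed.

Lemma is_derive1_powR p x : 0 < x ->
  is_derive x 1 (fun y : R => y `^ p) (p * x `^ p / x).
Proof.
move=> x0; apply: is_derive_eq (is_derive1_powR p x0) _.
rewrite powRB; last by rewrite (gt_eqF x0) implybT.
by rewrite powRr1 ?ltW// mulrA.
Qed.

Lemma within_continuous_for f x y :
  (forall z, x <= z <= y -> {for z, continuous f}) ->
  {within `[x, y], continuous f}.
Proof.
move=> fc; apply: continuous_in_subspaceT => z.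
by rewrite inE /= in_itv /=; exact: fc.
Qed.

Lemma MVT_open f df a b x y :
  (forall z, a < z < b -> is_derive z 1 f (df z)) ->
  a < x -> x < y -> y < b ->
  exists2 z, x < z < y & f y - f x = df z * (y - x).
Proof.
move=> fd ax xy yb; have := @MVT R f df x y xy.
case=> [z||z].
- rewrite in_itv /= => /andP[xz zy]; apply: fd.
  by rewrite (lt_trans ax xz) (lt_trans zy yb).
- apply: within_continuous_for => z /andP[xz zy].
  apply: (is_derive1_continuous (a := df z)); apply: fd.
  by rewrite (lt_le_trans ax xz) (le_lt_trans zy yb).
- by rewrite in_itv /= => zxy ?; exists z.
Qed.

Lemma derive_ge0_homo f df a b :
  (forall z, a < z < b -> is_derive z 1 f (df z)) ->
  (forall z, a < z < b -> 0 <= df z) ->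
  forall x y, a < x -> x <= y -> y < b -> f x <= f y.
Proof.
move=> fd df0 x y ax; rewrite le_eqVlt => /predU1P[->//|xy] yb.
have [z /andP[xz zy] e] := MVT_open fd ax xy yb.
rewrite -subr_ge0 e; apply: mulr_ge0; last by rewrite subr_ge0 ltW.
apply: df0.
by rewrite (lt_trans ax xz) (lt_trans zy yb).
Qed.

Lemma derive_le0_homo f df a b :
  (forall z, a < z < b -> is_derive z 1 f (df z)) ->
  (forall z, a < z < b -> df z <= 0) ->
  forall x y, a < x -> x <= y -> y < b -> f y <= f x.
Proof.
move=> fd df0 x y ax xy yb.
suff : - f x <= - f y by rewrite lerN2.
apply: (derive_ge0_homo (f := fun z => - f z) (df := fun z => - df z)
  (a := a) (b := b)) => // z zab.
- by have := is_deriveN (fd z zab).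
- by rewrite oppr_ge0; exact: df0.
Qed.

Lemma le_at_right0 g l r : g x @[x --> 0^'+] --> l -> 0 < r ->
  (forall x, 0 < x < r -> g r <= g x) -> g r <= l.
Proof.
move=> gl r0 h; rewrite -(cvg_lim _ gl)//; apply: limr_ge.
  by apply/cvg_ex; exists l.
near=> x; apply: h; apply/andP; split.
  by near: x; exact: nbhs_right_gt.
by near: x; exact: nbhs_right_lt.
Unshelve. all: by end_near. Qed.

Lemma ge_at_right0 g l r : g x @[x --> 0^'+] --> l -> 0 < r ->
  (forall x, 0 < x < r -> g x <= g r) -> l <= g r.
Proof.
move=> gl r0 h; rewrite -(cvg_lim _ gl)//; apply: limr_le.
  by apply/cvg_ex; exists l.
near=> x; apply: h; apply/andP; split.
  by near: x; exact: nbhs_right_gt.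
by near: x; exact: nbhs_right_lt.
Unshelve. all: by end_near. Qed.

Lemma cvg_exprn0 n : (0 < n)%N -> (x : R) ^+ n @[x --> 0^'+] --> (0 : R).
Proof.
move=> n0; have h : (x : R) ^+ n @[x --> (0 : R)] --> (0 : R) ^+ n.
  exact: exprn_continuous.
by rewrite expr0n gtn_eqF// in h; exact: cvg_at_right_filter.
Qed.

Lemma cvg_cmul (F : set_system R) {FF : Filter F} f k l :
  f x @[x --> F] --> l -> k * f x @[x --> F] --> k * l.
Proof. by move=> fl; apply: cvgM => //; exact: cvg_cst. Qed.

Lemma cvg_mul0 (F : set_system R) {FF : ProperFilter F} f g l :
  f x @[x --> F] --> (0 : R) -> g x @[x --> F] --> l ->
  f x * g x @[x --> F] --> (0 : R).
Proof. by move=> f0 gl; rewrite -(mul0r l); exact: cvgM. Qed.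

Lemma cvg_ext f g (F : set_system R) l l' : f x @[x --> F] --> l ->
  l = l' -> (forall x, f x = g x) -> g x @[x --> F] --> l'.
Proof. by move=> fl <- /funext <-. Qed.

Lemma cvg_near (T : Type) (f g : T -> R) (F : set_system T) {FF : Filter F} l :
  (\forall x \near F, f x = g x) ->
  f x @[x --> F] --> l -> g x @[x --> F] --> l.
Proof. by move=> fg; apply: cvg_trans; exact: near_eq_cvg. Qed.

End RealFunctions.
Arguments cvg_cmul {R F FF f} k {l}.
Arguments cvg_ext {R f g F l l'}.

(** * Comparison principles for the radial bilaplacian *)

Section RadialComparison.
Context {R : realType} (N : nat).
Implicit Types (W a v c f : R -> R) (r l : R).

(** A radial function [u x = W |x|] with [W' = r a] has Laplacian [r a' + N a].
Working with [a] rather than with [W'] keeps every profile of a smooth radial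
function continuous at 0, so that one and the same first order system describes
[W], its Laplacian [v] and its bilaplacian [f]. *)
Definition radial_system W a v c f := forall r, 0 < r < 1 ->
  [/\ is_derive r 1 W (r * a r), is_derive r 1 a ((v r - N%:R * a r) / r),
      is_derive r 1 v (r * c r) & is_derive r 1 c ((f r - N%:R * c r) / r)].

(** The behaviour at 0 shared by the profiles of classical solutions and by the
singular barrier: [W] and its iterated images under [r d/dr] have limits, and all
of these limits but that of [W] vanish. *)
Definition tame_at0 W a v c := [/\ exists l, W r @[r --> 0^'+] --> l,
  r ^+ 2 * a r @[r --> 0^'+] --> (0 : R),
  r ^+ 2 * v r @[r --> 0^'+] --> (0 : R) &
  r ^+ 4 * c r @[r --> 0^'+] --> (0 : R)].

(** The one-sided difference quotient of a profile which vanishes at 1. *)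
Definition slope_at1 W l := W (1 + h) / h @[h --> 0^'-] --> l.

Lemma radial_systemB W1 a1 v1 c1 f1 W2 a2 v2 c2 f2 :
  radial_system W1 a1 v1 c1 f1 -> radial_system W2 a2 v2 c2 f2 ->
  radial_system (fun r => W1 r - W2 r) (fun r => a1 r - a2 r)
    (fun r => v1 r - v2 r) (fun r => c1 r - c2 r) (fun r => f1 r - f2 r).
Proof.
move=> S1 S2 r r01; have [W1' a1' v1' c1'] := S1 r r01.
have [W2' a2' v2' c2'] := S2 r r01; split.
- by apply: is_derive1_eq (is_derive1_sub W1' W2'); rewrite mulrBr.
- by apply: is_derive1_eq (is_derive1_sub a1' a2'); ring.
- by apply: is_derive1_eq (is_derive1_sub v1' v2'); rewrite mulrBr.
- by apply: is_derive1_eq (is_derive1_sub c1' c2'); ring.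
Qed.

Lemma tame_at0B W1 a1 v1 c1 W2 a2 v2 c2 :
  tame_at0 W1 a1 v1 c1 -> tame_at0 W2 a2 v2 c2 ->
  tame_at0 (fun r => W1 r - W2 r) (fun r => a1 r - a2 r)
    (fun r => v1 r - v2 r) (fun r => c1 r - c2 r).
Proof.
move=> [[l1 W1l] a1l v1l c1l] [[l2 W2l] a2l v2l c2l]; split.
- by exists (l1 - l2); exact: cvgB.
- by apply: (cvg_ext (cvgB a1l a2l)) => [|r]; rewrite ?subr0// mulrBr.
- by apply: (cvg_ext (cvgB v1l v2l)) => [|r]; rewrite ?subr0// mulrBr.
- by apply: (cvg_ext (cvgB c1l c2l)) => [|r]; rewrite ?subr0// mulrBr.
Qed.

Lemma slope_at1B W1 l1 W2 l2 : slope_at1 W1 l1 -> slope_at1 W2 l2 ->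
  slope_at1 (fun r => W1 r - W2 r) (l1 - l2).
Proof.
by move=> s1 s2; apply: (cvg_ext (cvgB s1 s2)) => // h; rewrite mulrBl.
Qed.

Lemma slope_at1_linear (p : R) : slope_at1 (fun r => p * (r - 1)) p.
Proof.
apply: (cvg_near (f := fun=> p)); last exact: cvg_cst.
near=> h; have h0 : h != 0 by rewrite lt_eqF//; near: h; exact: nbhs_left_lt.
by rewrite addrAC subrr add0r mulfK.
Unshelve. all: by end_near. Qed.

Lemma slope_at1_derive W l : W 1 = 0 -> is_derive (1 : R) 1 W l -> slope_at1 W l.
Proof.
move=> W1 [Wd <-]; apply: cvg_dnbhs_at_left.
apply: (cvg_ext Wd) => // h /=.
by rewrite /GRing.scale /= mulr1 W1 subr0 mulrC addrC.
Qed.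

Lemma slope_at1_cvg W l : slope_at1 W l -> W (1 + h) @[h --> 0^'-] --> (0 : R).
Proof.
move=> Wl; have h0 : (h : R) @[h --> 0^'-] --> (0 : R).
  exact: cvg_at_left_filter.
apply: (cvg_near _ (cvg_mul0 h0 Wl)).
near=> h; rewrite mulrC divfK// lt_eqF//; near: h; exact: nbhs_left_lt.
Unshelve. all: by end_near. Qed.

Lemma slope_at1_lt W l e : slope_at1 W l -> 0 < e ->
  forall r, r < 1 -> exists2 s, r < s < 1 & `|W s - l * (s - 1)| <= e * (1 - s).
Proof.
move=> Wl e0 r r1.
suff [h [h0 rh]] : exists h : R, [/\ h < 0, r < 1 + h &
    `|W (1 + h) / h - l| <= e].
  move=> H; exists (1 + h); first by rewrite rh /= gtrDl.
  have -> : W (1 + h) - l * (1 + h - 1) = (W (1 + h) / h - l) * h.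
    by field; rewrite lt_eqF.
  by rewrite normrM (ltr0_norm h0) opprD addNKr ler_wpM2r// oppr_ge0 ltW.
have /cvgrPdist_le /(_ _ e0) H := Wl.
near (0 : R)^'- => h; exists h; split.
- by near: h; exact: nbhs_left_lt.
- rewrite -ltrBlDl; near: h; apply: nbhs_left_gt.
  by rewrite subr_lt0.
- by rewrite distrC; near: h.
Unshelve. all: by end_near. Qed.

(** The existence of a slope makes [W] tend to 0 at 1, so that a nonincreasing [W]
cannot have been negative before. Quantitatively, [|W s|] is at most
[(|l| + 1) (1 - s)] at points [s] arbitrarily close to 1. *)
Lemma nonincreasing_slope_ge0 b W l : slope_at1 W l ->
  (forall x y, b < x -> x <= y -> y < 1 -> W y <= W x) ->
  forall r, b < r < 1 -> 0 <= W r.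
Proof.
move=> Wl Wd r /andP[r0 r1]; rewrite leNgt; apply/negP => Wr.
have e0 : 0 < - W r / (`|l| + 2).
  by rewrite divr_gt0 ?oppr_gt0// ltr_wpDl.
pose r' := Num.max r (1 - - W r / (`|l| + 2)).
have r'1 : r' < 1 by rewrite gt_max r1/= gtrBl.
have [s /andP[r's s1] hs] := slope_at1_lt Wl ltr01 r'1.
have rs : r < s by apply: le_lt_trans r's; rewrite le_max lexx.
have Ws : W s <= W r by apply: Wd => //; exact: ltW.
have es : (1 - s) * (`|l| + 2) < - W r.
  rewrite -ltr_pdivlMr ?ltr_wpDl// ltrBlDl -ltrBlDr.
  by apply: le_lt_trans r's; rewrite le_max lexx orbT.
have : - W s <= (1 - s) * (`|l| + 1).
  have -> : - W s = - (W s - l * (s - 1)) + l * (1 - s) by ring.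
  have : - (W s - l * (s - 1)) <= 1 * (1 - s).
    by apply: le_trans hs; rewrite -normrN ler_norm.
  have : l * (1 - s) <= `|l| * (1 - s).
    by rewrite ler_wpM2r ?ler_norm// subr_ge0 ltW.
  lra.
have : 0 < 1 - s by rewrite subr_gt0.
nra.
Qed.

(** The divergence form of the radial equations, [(r^N a)' = r^(N-1) (r a' + N a)]. *)
Lemma is_derive1_weighted r (g : R -> R) (d : R) : 0 < r ->
  is_derive r 1 g ((d - N%:R * g r) / r) -> (0 < N)%N ->
  is_derive r 1 (fun r => r ^+ N * g r) (r ^+ N.-1 * d).
Proof.
move=> r0 gd N0; apply: is_derive1_eq (is_derive1_mul (is_derive1_exprn N r) gd).
rewrite -{3}(prednK N0) exprS; field; by rewrite gt_eqF.
Qed.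

(** Boggio's positivity principle for the clamped plate, which is elementary for
radial functions. As [(r^N c)' = r^(N-1) f] is nonnegative and [r^N c] vanishes
at 0, [v] is nondecreasing. Were [P := r^N a] positive at some point, then [v],
the sign of [P'], would be positive somewhere before it, hence from there on, so that [P]
would keep increasing and [W' = r a] would stay above a positive constant up to
1, against the sign of the slope. So [a] is nonpositive, and [W] decreases to 0. *)
Lemma radial_boggio W a v c f l : (4 < N)%N -> l <= 0 ->
  radial_system W a v c f -> tame_at0 W a v c -> slope_at1 W l ->
  (forall r, 0 < r < 1 -> 0 <= f r) ->
  forall r, 0 < r < 1 -> a r <= 0 /\ 0 <= W r.
Proof.
move=> N4 l0 S [_ a0 v0 c0] Wl f0.
have N0 : (0 < N)%N by apply: leq_trans N4.
pose Q r := r ^+ N * c r; pose P r := r ^+ N * a r.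
have Q0 : Q r @[r --> 0^'+] --> (0 : R).
  have N4' : (0 < N - 4)%N by rewrite subn_gt0.
  apply: (cvg_ext (cvg_mul0 (cvg_exprn0 N4') c0)) => // r.
  by rewrite mulrA -exprD subnK// ltnW.
have P0 : P r @[r --> 0^'+] --> (0 : R).
  have N2' : (0 < N - 2)%N by rewrite subn_gt0 (leq_trans _ N4).
  apply: (cvg_ext (cvg_mul0 (cvg_exprn0 N2') a0)) => // r.
  by rewrite mulrA -exprD subnK// ltnW// (leq_trans _ N4).
have dQ r : 0 < r < 1 -> is_derive r 1 Q (r ^+ N.-1 * f r).
  move=> r01; have [_ _ _ cd] := S r r01.
  by apply: is_derive1_weighted => //; case/andP: r01.
have dP r : 0 < r < 1 -> is_derive r 1 P (r ^+ N.-1 * v r).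
  move=> r01; have [_ ad _ _] := S r r01.
  by apply: is_derive1_weighted => //; case/andP: r01.
have cge0 r : 0 < r < 1 -> 0 <= c r.
  move=> /andP[r0 r1]; rewrite -(pmulr_rge0 _ (exprn_gt0 N r0)).
  apply: (ge_at_right0 Q0 r0) => x /andP[x0 xr].
  apply: (derive_ge0_homo dQ) => //; last exact: ltW.
  by move=> z z01; rewrite mulr_ge0 ?f0// exprn_ge0// ltW//; case/andP: z01.
have vmono x y : 0 < x -> x <= y -> y < 1 -> v x <= v y.
  apply: (derive_ge0_homo (df := fun r => r * c r)) => z z01.
    by have [] := S z z01.
  by rewrite mulr_ge0 ?cge0// ltW//; case/andP: z01.
have ale0 r : 0 < r < 1 -> a r <= 0.
  move=> /andP[r0 r1]; rewrite leNgt; apply/negP => ar0.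
  have Pr0 : 0 < P r by rewrite mulr_gt0// exprn_gt0.
  have [x /andP[x0 xr] Px] : exists2 x, 0 < x < r & P x < P r.
    apply: contrapT => H; move: Pr0; apply/negP; rewrite -leNgt.
    apply: (le_at_right0 P0 r0) => x xr; rewrite leNgt; apply/negP => Px.
    by apply: H; exists x.
  have [z /andP[xz zr] Pz] := MVT_open dP x0 xr r1.
  have z0 : 0 < z by exact: lt_trans xz.
  have vz : 0 < v z.
    rewrite -(pmulr_rgt0 _ (exprn_gt0 N.-1 z0)).
    rewrite -(@pmulr_lgt0 _ (r - x)) ?subr_gt0//; lra.
  have Pmono s : r <= s -> s < 1 -> P r <= P s.
    move=> rs s1; apply: (derive_ge0_homo (a := z) (b := 1) (f := P)
      (df := fun r => r ^+ N.-1 * v r)) => // t /andP[zt t1].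
      by apply: dP; rewrite t1 (lt_trans z0).
    have t0 := lt_trans z0 zt.
    rewrite mulr_ge0 ?exprn_ge0 1?ltW//; apply: (lt_le_trans vz).
    by apply: vmono => //; exact: ltW.
  pose g s := P r * (s - 1) - W s.
  have gl : slope_at1 g (P r - l).
    by apply: slope_at1B => //; exact: slope_at1_linear.
  have gd s : r < s < 1 -> is_derive s 1 g (P r - s * a s).
    move=> /andP[rs s1]; have s01 : 0 < s < 1 by rewrite s1 (lt_trans r0).
    have [Wd _ _ _] := S s s01.
    apply: is_derive1_sub => //.
    apply: is_derive1_eq (is_derive1_cmul (P r) 
      (is_derive1_sub (is_derive1_id s) (is_derive1_cst 1 s))).
    by rewrite subr0 mulr1.
  have g0 s : r < s < 1 -> 0 <= g s.
    apply: (nonincreasing_slope_ge0 gl); apply: (derive_le0_homo gd) => t /andP[rt t1].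
    rewrite subr_le0; apply: le_trans (Pmono t (ltW rt) t1) _.
    have t0 : 0 < t by exact: lt_trans rt.
    have at0 : 0 <= a t.
      rewrite -(pmulr_rge0 _ (exprn_gt0 N t0)).
      exact: le_trans (ltW Pr0) (Pmono t (ltW rt) t1).
    rewrite /P -(prednK N0) exprSr -mulrA ler_piMl//.
      by rewrite mulr_ge0// ltW.
    by rewrite exprn_ile1// ltW.
  have e0 : 0 < P r / 2 by rewrite divr_gt0.
  have [s /andP[rs s1] hs] := slope_at1_lt Wl e0 r1.
  have := g0 s; rewrite rs s1 => /(_ isT); rewrite /g => gs.
  have : - (W s - l * (s - 1)) <= P r / 2 * (1 - s).
    by apply: le_trans hs; rewrite -normrN ler_norm.
  have : 0 < 1 - s by rewrite subr_gt0.
  nra.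
move=> r r01; split; first exact: ale0.
apply: (nonincreasing_slope_ge0 (b := 0) Wl) => //.
apply: (derive_le0_homo (df := fun r => r * a r)) => z z01.
  by have [] := S z z01.
by rewrite mulr_ge0_le0 ?ale0// ltW//; case/andP: z01.
Qed.

(** [r^(-al) g] is nonincreasing, and it vanishes at 0 because [al] is negative and
[g] is bounded there. *)
Lemma euler_factor_le0 (al l : R) (g dg : R -> R) : al < 0 ->
  g r @[r --> 0^'+] --> l ->
  (forall r, 0 < r < 1 -> is_derive r 1 g (dg r)) ->
  (forall r, 0 < r < 1 -> r * dg r <= al * g r) ->
  forall r, 0 < r < 1 -> g r <= 0.
Proof.
move=> al0 gl gd gle r /andP[r0 r1].
pose h r := r `^ (- al) * g r.
have hd (s : R) : 0 < s < 1 ->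
    is_derive s 1 h (s `^ (- al) / s * (s * dg s - al * g s)).
  move=> /[dup] s01 /andP[s0 s1].
  apply: is_derive1_eq (is_derive1_mul (is_derive1_powR (- al) s0) (gd s s01)).
  by field; rewrite gt_eqF.
have h0 : h x @[x --> 0^'+] --> (0 : R).
  by apply: (cvg_mul0 _ gl); apply: powR_cvg0; rewrite oppr_gt0.
rewrite -(pmulr_rle0 _ (powR_gt0 (- al) r0)).
apply: (le_at_right0 h0 r0) => x /andP[x0 xr].
apply: (derive_le0_homo hd) => //; last exact: ltW.
move=> s /[dup] s01 /andP[s0 s1].
by rewrite mulr_ge0_le0 ?subr_le0 ?gle// divr_ge0 ?powR_ge0// ltW.
Qed.

(** [sg] and [ta] are the square roots of the two roots [y] of the quadratic
equation [(y - A) (y - B) = k], where [A = ((N - 4) / 2)^2] and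
[B = (N / 2)^2]. The bound on [k] is the Hardy-Rellich one, [k <= A B], which makes
the smaller root nonnegative. *)
Lemma indicial_roots (k : R) : (4 < N)%N -> 0 < k ->
  16 * k <= N%:R ^+ 2 * (N%:R - 4) ^+ 2 ->
  exists sg ta : R, [/\ 0 <= sg, sg < (N%:R - 4) / 2, N%:R / 2 < ta,
   sg ^+ 2 + ta ^+ 2 = ((N%:R - 4) / 2) ^+ 2 + (N%:R / 2) ^+ 2 &
   sg ^+ 2 * ta ^+ 2 = ((N%:R - 4) / 2) ^+ 2 * (N%:R / 2) ^+ 2 - k].
Proof.
move=> N4 k0 hk; set n : R := N%:R in hk *.
have n4 : 4 < n by rewrite /n (ltr_nat _ 4).
set A := ((n - 4) / 2) ^+ 2; set B := (n / 2) ^+ 2.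
have A0 : 0 <= A by exact: sqr_ge0.
have AB : A < B.
  by rewrite ltr_pXn2r// ?nnegrE; lra.
have kAB : k <= A * B by rewrite /A /B; lra.
pose D := Num.sqrt ((B - A) ^+ 2 + 4 * k).
have D2 : D ^+ 2 = (B - A) ^+ 2 + 4 * k.
  by rewrite sqr_sqrtr// addr_ge0 ?sqr_ge0// mulr_ge0// ltW.
have D0 : 0 <= D by exact: sqrtr_ge0.
have DBA : B - A < D.
  rewrite -(@ltr_pXn2r _ 2)// ?nnegrE ?subr_ge0 1?ltW//.
  by rewrite D2 ltrDl mulr_gt0.
have DAB : D <= A + B.
  rewrite -(@ler_pXn2r _ 2)// ?nnegrE ?addr_ge0 ?sqr_ge0// D2.
  by nra.
have y1 : 0 <= (A + B - D) / 2 by rewrite divr_ge0// subr_ge0.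
have y2 : 0 <= (A + B + D) / 2 by rewrite divr_ge0// !addr_ge0// sqr_ge0.
exists (Num.sqrt ((A + B - D) / 2)), (Num.sqrt ((A + B + D) / 2)); split.
- exact: sqrtr_ge0.
- rewrite -(@ltr_pXn2r _ 2)// ?nnegrE ?sqrtr_ge0//; last lra.
  by rewrite sqr_sqrtr// -/A; lra.
- rewrite -(@ltr_pXn2r _ 2)// ?nnegrE ?sqrtr_ge0//; last lra.
  by rewrite sqr_sqrtr// -/B; lra.
- by rewrite !sqr_sqrtr//; field.
- rewrite !sqr_sqrtr//.
  have -> : (A + B - D) / 2 * ((A + B + D) / 2) = ((A + B) ^+ 2 - D ^+ 2) / 4 by field.
  by rewrite D2; field.
Qed.

(** With [D = r d/dr], the operator [r^4 Laplacian^2 - k] acts on radial functions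
as [(D - al1) (D - al2) (D - al3) (D - al4)], the exponents being
[(4 - N) / 2 -+ ta] and [(4 - N) / 2 -+ sg]. Below the Hardy-Rellich constant they
are real, the first three are negative, and [euler_factor_le0] peels them off one
after the other: [(D - al4) W] is nonpositive. Thus [r^(-al4) W] is nonincreasing,
and since [W] vanishes at 1 it was nonnegative.

One condition at 1 suffices, because among the four homogeneous solutions
[r^al] only [r^al4] is bounded at 0, and it does not vanish at 1. *)
Lemma hardy_rellich_comparison W a v c f l (k : R) : (4 < N)%N -> 0 < k ->
  16 * k <= N%:R ^+ 2 * (N%:R - 4) ^+ 2 ->
  radial_system W a v c f -> tame_at0 W a v c -> slope_at1 W l ->
  (forall r, 0 < r < 1 -> r ^+ 4 * f r <= k * W r) ->
  forall r, 0 < r < 1 -> 0 <= W r.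
Proof.
move=> N4 k0 hk S [[L WL] a0 v0 c0] Wl hf.
have [sg [ta [sg0 sgA taB E1 E2]]] := indicial_roots N4 k0 hk.
set n : R := N%:R in sgA taB E1 E2.
pose m := (4 - n) / 2.
pose al1 := m - ta; pose al2 := m - sg; pose al3 := m + sg; pose al4 := m + ta.
pose T1 r := r ^+ 2 * a r.
pose T2 r := r ^+ 2 * v r + (2 - n) * T1 r.
pose T3 r := r ^+ 4 * c r + (4 - n) * (r ^+ 2 * v r) + (2 - n) ^+ 2 * T1 r.
have ad r : 0 < r < 1 -> is_derive r 1 T1 (T2 r / r).
  move=> /[dup] r01 /andP[r0 _]; have [_ h _ _] := S r r01.
  apply: is_derive1_eq (is_derive1_mul (is_derive1_exprn 2 r) h).
  by rewrite /T2 /T1 /n /=; field; rewrite gt_eqF.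
have vd r : 0 < r < 1 -> is_derive r 1 (fun r => r ^+ 2 * v r)
    ((2 * (r ^+ 2 * v r) + r ^+ 4 * c r) / r).
  move=> /[dup] r01 /andP[r0 _]; have [_ _ h _] := S r r01.
  apply: is_derive1_eq (is_derive1_mul (is_derive1_exprn 2 r) h).
  by rewrite /=; field; rewrite gt_eqF.
have cd r : 0 < r < 1 -> is_derive r 1 (fun r => r ^+ 4 * c r)
    (((4 - n) * (r ^+ 4 * c r) + r ^+ 4 * f r) / r).
  move=> /[dup] r01 /andP[r0 _]; have [_ _ _ h] := S r r01.
  apply: is_derive1_eq (is_derive1_mul (is_derive1_exprn 4 r) h).
  by rewrite /n /=; field; rewrite gt_eqF.
have Wd r : 0 < r < 1 -> is_derive r 1 W (T1 r / r).
  move=> /[dup] r01 /andP[r0 _]; have [h _ _ _] := S r r01.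
  by apply: is_derive1_eq h; rewrite /T1; field; rewrite gt_eqF.
have T2d r : 0 < r < 1 -> is_derive r 1 T2 (T3 r / r).
  move=> /[dup] r01 /andP[r0 _].
  apply: is_derive1_eq (is_derive1_add (vd r r01) (is_derive1_cmul (2 - n) (ad r r01))).
  by rewrite /T3 /T2; field; rewrite gt_eqF.
pose T4 r := (4 - n) * (r ^+ 4 * c r) + r ^+ 4 * f r
   + (4 - n) * (2 * (r ^+ 2 * v r) + r ^+ 4 * c r) + (2 - n) ^+ 2 * T2 r.
have T3d r : 0 < r < 1 -> is_derive r 1 T3 (T4 r / r).
  move=> /[dup] r01 /andP[r0 _].
  apply: is_derive1_eq (is_derive1_add (is_derive1_add (cd r r01)
    (is_derive1_cmul (4 - n) (vd r r01))) (is_derive1_cmul ((2 - n) ^+ 2) (ad r r01))).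
  by rewrite /T4; field; rewrite gt_eqF.
have T1l : T1 r @[r --> 0^'+] --> (0 : R) by [].
have T2l : T2 r @[r --> 0^'+] --> (0 : R).
  by apply: (cvg_ext (cvgD v0 (cvg_cmul (2 - n) T1l))) => //; rewrite mulr0 addr0.
have T3l : T3 r @[r --> 0^'+] --> (0 : R).
  apply: (cvg_ext (cvgD (cvgD c0 (cvg_cmul (4 - n) v0))
    (cvg_cmul ((2 - n) ^+ 2) T1l))) => //.
  by rewrite !mulr0 !addr0.
(* [ch] and [et] are (D - al3) (D - al4) W and (D - al2) (D - al3) (D - al4) W,
   while [ze] is (D - al4) W. *)
pose ze r := T1 r - al4 * W r.
pose ch r := T2 r - (al3 + al4) * T1 r + al3 * al4 * W r.
pose et r := T3 r - (al2 + al3 + al4) * T2 r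
   + (al2 * al3 + al2 * al4 + al3 * al4) * T1 r - al2 * al3 * al4 * W r.
have key r : T4 r - (al1 + al2 + al3 + al4) * T3 r
  + (al1 * al2 + al1 * al3 + al1 * al4 + al2 * al3 + al2 * al4 + al3 * al4) * T2 r
  - (al1 * al2 * al3 + al1 * al2 * al4 + al1 * al3 * al4 + al2 * al3 * al4) * T1 r
  + al1 * al2 * al3 * al4 * W r = r ^+ 4 * f r - k * W r.
  have -> : al1 + al2 + al3 + al4 = 4 * m by rewrite /al1 /al2 /al3 /al4; ring.
  have -> : al1 * al2 + al1 * al3 + al1 * al4 + al2 * al3 + al2 * al4 + al3 * al4
     = 6 * m ^+ 2 - (sg ^+ 2 + ta ^+ 2) by rewrite /al1 /al2 /al3 /al4; ring.
  have -> : al1 * al2 * al3 + al1 * al2 * al4 + al1 * al3 * al4 + al2 * al3 * al4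
     = 4 * m ^+ 3 - 2 * m * (sg ^+ 2 + ta ^+ 2) by rewrite /al1 /al2 /al3 /al4; ring.
  have -> : al1 * al2 * al3 * al4 = m ^+ 4 - m ^+ 2 * (sg ^+ 2 + ta ^+ 2) + sg ^+ 2 * ta ^+ 2
     by rewrite /al1 /al2 /al3 /al4; ring.
  by rewrite E1 E2 /T4 /T3 /T2 /m; field.
have etd r : 0 < r < 1 -> is_derive r 1 et ((T4 r - (al2 + al3 + al4) * T3 r
   + (al2 * al3 + al2 * al4 + al3 * al4) * T2 r - al2 * al3 * al4 * T1 r) / r).
  move=> r01.
  apply: is_derive1_eq (is_derive1_sub (is_derive1_add (is_derive1_sub (T3d r r01)
    (is_derive1_cmul _ (T2d r r01))) (is_derive1_cmul _ (ad r r01)))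
    (is_derive1_cmul _ (Wd r r01))).
  by ring.
have chd r : 0 < r < 1 -> is_derive r 1 ch
    ((T3 r - (al3 + al4) * T2 r + al3 * al4 * T1 r) / r).
  move=> r01.
  apply: is_derive1_eq (is_derive1_add (is_derive1_sub (T2d r r01)
    (is_derive1_cmul _ (ad r r01))) (is_derive1_cmul _ (Wd r r01))).
  by ring.
have zed r : 0 < r < 1 -> is_derive r 1 ze ((T2 r - al4 * T1 r) / r).
  move=> r01.
  apply: is_derive1_eq (is_derive1_sub (ad r r01) (is_derive1_cmul _ (Wd r r01))).
  by ring.
have al10 : al1 < 0 by rewrite /al1 /m; lra.
have al20 : al2 < 0 by rewrite /al2 /m; lra.
have al30 : al3 < 0 by rewrite /al3 /m; lra.
have etle r : 0 < r < 1 -> et r <= 0.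
  apply: (euler_factor_le0 al10 _ etd).
    exact: (cvgB (cvgD (cvgB T3l (cvg_cmul _ T2l)) (cvg_cmul _ T1l)) (cvg_cmul _ WL)).
  move=> s /[dup] s01 /andP[s0 _]; rewrite mulrC divfK ?gt_eqF//.
  by have := hf s s01; rewrite -subr_le0 -key /et; lra.
have chle r : 0 < r < 1 -> ch r <= 0.
  apply: (euler_factor_le0 al20 _ chd).
    exact: (cvgD (cvgB T2l (cvg_cmul _ T1l)) (cvg_cmul _ WL)).
  move=> s /[dup] s01 /andP[s0 _]; rewrite mulrC divfK ?gt_eqF//.
  by have := etle s s01; rewrite /et /ch; lra.
have zele r : 0 < r < 1 -> ze r <= 0.
  apply: (euler_factor_le0 al30 _ zed).
    exact: (cvgB T1l (cvg_cmul _ WL)).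
  move=> s /[dup] s01 /andP[s0 _]; rewrite mulrC divfK ?gt_eqF//.
  by have := chle s s01; rewrite /ze /ch; lra.
move=> r /[dup] r01 /andP[r0 r1]; rewrite leNgt; apply/negP => Wr.
have al40 : 0 < al4 by rewrite /al4 /m; lra.
(* As [al4 > 0], a negative value [W r] bounds W from above on the whole of
   [r, 1[, which is incompatible with the limit 0. *)
pose g s := s `^ (- al4) * W s.
have gd (s : R) : 0 < s < 1 -> is_derive s 1 g (s `^ (- al4) / s * ze s).
  move=> /[dup] s01 /andP[s0 s1].
  apply: is_derive1_eq (is_derive1_mul (is_derive1_powR (- al4) s0) (Wd s s01)).
  by rewrite /ze; field; rewrite gt_eqF.
have gmono x y : 0 < x -> x <= y -> y < 1 -> g y <= g x.
  apply: (derive_le0_homo gd) => s /[dup] s01 /andP[s0 _].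
  by rewrite mulr_ge0_le0 ?zele// divr_ge0 ?powR_ge0// ltW.
have Wle s : r <= s -> s < 1 -> W s <= W r.
  move=> rs s1; have s0 := lt_le_trans r0 rs.
  have := gmono r s r0 rs s1; rewrite /g !powRN => gle.
  have rsp : r `^ al4 <= s `^ al4 by apply: ge0_ler_powR; rewrite ?nnegrE// ltW.
  have rp := powR_gt0 al4 r0; have sp := powR_gt0 al4 s0.
  have : W s <= s `^ al4 / r `^ al4 * W r.
    rewrite -(ler_pM2l (_ : 0 < (s `^ al4)^-1)) ?invr_gt0//.
    by rewrite mulrA mulrA mulVf ?gt_eqF// mul1r.
  move=> /le_trans; apply.
  rewrite -[leRHS]mul1r; apply: ler_wnM2r; first exact: ltW.
  by rewrite ler_pdivlMr// mul1r.
have := slope_at1_cvg Wl => /cvgrPdist_lt /(_ (- W r)).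
rewrite oppr_gt0 => /(_ Wr) H.
near (0 : R)^'- => h.
have : `|0 - W (1 + h)| < - W r by near: h.
rewrite sub0r normrN; apply/negP; rewrite -leNgt.
have hW : W (1 + h) <= W r.
  apply: Wle.
    rewrite -lerBlDl; apply: ltW; near: h; apply: nbhs_left_gt.
    by rewrite subr_lt0.
  by rewrite gtrDl; near: h; exact: nbhs_left_lt.
by rewrite ler0_norm ?lerN2//; apply: le_trans hW _; exact: ltW.
Unshelve. all: by end_near. Qed.


Definition barrier r : R := 1 - r `^ (4 / 3).
(** [barrier_const] is the parameter for which the barrier solves the equation away
from the origin: [Laplacian^2 (1 - r^(4/3)) = barrier_const * r^(-8/3)], and
[r^(-8/3)] is [1 / (1 - barrier)^2]. *)
Definition barrier_const : R := 8 / 9 * (N%:R - 2 / 3) * (N%:R - 8 / 3).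

Lemma barrier_system : radial_system barrier
  (fun r => - (4 / 3) * r `^ (- (2 / 3)))
  (fun r => - (4 / 3) * (N%:R - 2 / 3) * r `^ (- (2 / 3)))
  (fun r => 8 / 9 * (N%:R - 2 / 3) * r `^ (- (8 / 3)))
  (fun r => barrier_const * r `^ (- (8 / 3))).
Proof.
move=> r /andP[r0 r1].
have p1 : r `^ (4 / 3) = r ^+ 2 * r `^ (- (2 / 3)).
  rewrite -powR_mulrn ?ltW// -powRD; last by rewrite (gt_eqF r0) implybT.
  by congr (_ `^ _); field.
have p2 : r `^ (- (2 / 3)) = r ^+ 2 * r `^ (- (8 / 3)).
  rewrite -powR_mulrn ?ltW// -powRD; last by rewrite (gt_eqF r0) implybT.
  by congr (_ `^ _); field.
have r_n0 : r != 0 by rewrite gt_eqF.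
split.
- apply: is_derive1_eq (is_derive1_sub (is_derive1_cst 1 r) (is_derive1_powR _ r0)).
  by rewrite p1; field.
- apply: is_derive1_eq (is_derive1_cmul _ (is_derive1_powR _ r0)).
  by field.
- apply: is_derive1_eq (is_derive1_cmul _ (is_derive1_powR _ r0)).
  by rewrite p2; field.
- apply: is_derive1_eq (is_derive1_cmul _ (is_derive1_powR _ r0)).
  by rewrite /barrier_const; field.
Qed.

Lemma barrier_tame : tame_at0 barrier
  (fun r => - (4 / 3) * r `^ (- (2 / 3)))
  (fun r => - (4 / 3) * (N%:R - 2 / 3) * r `^ (- (2 / 3)))
  (fun r => 8 / 9 * (N%:R - 2 / 3) * r `^ (- (8 / 3))).
Proof.
have p0 : (r : R) `^ (4 / 3) @[r --> 0^'+] --> (0 : R).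
  by apply: powR_cvg0; lra.
have pE (n : nat) (p : R) : n%:R + p = 4 / 3 -> forall k : R,
    r ^+ n * (k * r `^ p) @[r --> 0^'+] --> (0 : R).
  move=> npE k; have H : k * r `^ (4 / 3) @[r --> 0^'+] --> k * 0.
    exact: cvg_cmul.
  rewrite mulr0 in H.
  apply: (cvg_near _ H).
  near=> r; have r0 : 0 < r by near: r; exact: nbhs_right_gt.
  rewrite -npE powRD; last by rewrite (gt_eqF r0) implybT.
  by rewrite powR_mulrn ?ltW// mulrCA.
split.
- exists (1 - 0); apply: cvgB => //; exact: cvg_cst.
- by apply: pE; field.
- by apply: pE; field.
- by apply: pE; field.
Unshelve. all: by end_near. Qed.

Lemma barrier_slope : slope_at1 barrier (- (4 / 3)).
Proof.
apply: slope_at1_derive; first by rewrite /barrier powR1 subrr.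
apply: is_derive1_eq (is_derive1_sub (is_derive1_cst 1 1) (is_derive1_powR _ ltr01)).
by rewrite powR1; field.
Qed.

End RadialComparison.

(** * The linear radial problem and its regularity *)

Section RadialSolver.
Context {R : realType}.
Implicit Types (f g h F : R -> R) (r x : R).

(** The base point -1 makes the primitive differentiable at 0 as well. *)
Lemma antiderivative g : continuous g ->
  exists F, forall x, -1 < x -> is_derive x 1 F (g x).
Proof.
move=> gc.
exists (fun x => \int[@lebesgue_measure R]_(t in [set` `[-1, x]]) g t)%R => x x1.
have x2 : x < x + 1 by rewrite ltrDl.
have gi : (@lebesgue_measure R).-integrable `[-1, x + 1] (EFin \o g).
  apply: continuous_compact_integrable; first exact: segment_compact.
  exact: continuous_subspaceT.
have [Fd Fx] := continuous_FTC1_closed x2 gi x1 (gc x).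
rewrite derive1E in Fx; exact: DeriveDef Fd Fx.
Qed.

Lemma continuous_max0 F : (forall x, 0 <= x -> {for x, continuous F}) ->
  continuous (fun x => F (Num.max x 0)).
Proof.
move=> Fc x; apply: (@continuous_comp _ _ _ (fun x : R => Num.max x 0) F).
  by apply: continuous_max; [exact: cvg_id|exact: cvg_cst].
by apply: Fc; rewrite le_max lexx orbT.
Qed.

Lemma is_derive1_pos_ext f g r d : 0 < r -> (forall x, 0 < x -> f x = g x) ->
  is_derive r 1 f d -> is_derive r 1 g d.
Proof.
move=> r0 fg; apply: near_eq_is_derive.
by near=> x; apply: fg; near: x; exact: lt_nbhsr.
Unshelve. all: by end_near. Qed.

Lemma exists_primitive g : continuous g ->
  exists F, [/\ continuous F, F 1 = 0 & forall r, 0 < r -> is_derive r 1 F (g r)].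
Proof.
move=> gc; have [F Fd] := antiderivative gc.
exists (fun x => F (Num.max x 0) - F 1); split.
- move=> x; apply: cvgB; last exact: cvg_cst.
  apply: (continuous_max0 (F := F)) => {}x x0.
  by apply: is_derive1_continuous (Fd x _); lra.
- by rewrite max_l ?subrr.
- move=> r r0; have r1 : -1 < r by lra.
  apply: (is_derive1_pos_ext (f := fun x => F x - F 1)) => //.
    by move=> x x0; rewrite max_l ?ltW.
  by apply: is_derive1_eq (is_derive1_sub (Fd r r1) (is_derive1_cst _ r)); rewrite subr0.
Qed.

(** The solution is [r^(-n)] times the primitive of [t^(n-1) h] that vanishes at 0.
By the mean value theorem its distance to [h 0 / n] is at most the oscillation of
[h] on [0, r], whence the continuity at 0. *)
Lemma euler_solver (n : nat) h : (0 < n)%N -> continuous h ->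
  exists2 a : R -> R, continuous a &
    forall r, 0 < r -> is_derive r 1 a ((h r - n%:R * a r) / r).
Proof.
move=> n0 hc; have nR0 : (n%:R : R) != 0 by rewrite pnatr_eq0 -lt0n.
have [|F Fd] := antiderivative (g := fun t => t ^+ n.-1 * h t).
  by move=> x; apply: cvgM; [exact: exprn_continuous|exact: hc].
pose b r := (F r - F 0) / r ^+ n.
pose a r := if r <= 0 then h 0 / n%:R else b r.
have ab r : 0 < r -> a r = b r by rewrite /a ltNge => /negbTE ->.
have bd r : 0 < r -> is_derive r 1 b ((h r - n%:R * b r) / r).
  move=> r0; have r1 : -1 < r by lra.
  have rn0 : r ^+ n != 0 by rewrite expf_neq0// gt_eqF.
  have rn10 : r ^+ n.-1 != 0 by rewrite expf_neq0// gt_eqF.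
  apply: is_derive1_eq (is_derive1_mul (is_derive1_sub (Fd r r1) (is_derive1_cst (F 0) r))
    (is_derive1_inv (f := fun y => y ^+ n) rn0
      (is_derive1_exprn n r))).
  have rnE : r ^+ n = r * r ^+ n.-1 by rewrite -exprS prednK.
  by rewrite /b rnE; field; rewrite (gt_eqF r0) rn10.
have ad r : 0 < r -> is_derive r 1 a ((h r - n%:R * a r) / r).
  move=> r0; rewrite ab//; apply: (is_derive1_pos_ext r0 _ (bd r r0)) => x x0.
  by rewrite ab.
exists a => // x; have [x0|x0|->] := ltgtP x 0.
- apply: (near_cst_continuous (h 0 / n%:R)).
  by near=> y; rewrite /a ifT// ltW//; near: y; exact: lt_nbhsl.
- exact: is_derive1_continuous (ad x x0).
- have a0E : a 0 = h 0 / n%:R by rewrite /a lexx.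
  rewrite /continuous_at a0E; apply/cvgrPdist_le => e e0.
  have /cvgrPdist_le /(_ _ e0) [/= d d0 hd] := hc 0.
  near=> r; rewrite /a; case: ifPn => [r0|]; first by rewrite subrr normr0 ltW.
  rewrite -ltNge => r0; rewrite /b.
  have kd z : -1 < z < r + 1 -> is_derive z 1
     (fun t => F t - h 0 / n%:R * t ^+ n) (z ^+ n.-1 * (h z - h 0)).
    move=> /andP[z1 _].
    apply: is_derive1_eq (is_derive1_sub (Fd z z1)
      (is_derive1_cmul _ (is_derive1_exprn n z))).
    by field.
  have [] := MVT_open kd _ r0; rewrite ?ltrN10 ?ltrDl// => z /andP[z0 zr].
  rewrite expr0n (gtn_eqF n0) mulr0n mulr0 !subr0 => E.
  have rn0 : 0 < r ^+ n by rewrite exprn_gt0.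
  have -> : h 0 / n%:R - (F r - F 0) / r ^+ n =
     z ^+ n.-1 * (h 0 - h z) * r / r ^+ n.
    have -> : F r = z ^+ n.-1 * (h z - h 0) * r + F 0 + h 0 / n%:R * r ^+ n.
      by rewrite -E; ring.
    by field; rewrite nR0 (gt_eqF rn0).
  rewrite -(prednK n0) exprSr (prednK n0).
  have -> : z ^+ n.-1 * (h 0 - h z) * r / (r ^+ n.-1 * r) = (z / r) ^+ n.-1 * (h 0 - h z).
    by rewrite exprMn exprVn; field; rewrite (gt_eqF r0) expf_neq0// gt_eqF.
  rewrite normrM -[leRHS]mul1r ler_pM ?normr_ge0//.
    rewrite normrX exprn_ile1// ger0_norm ?divr_ge0// ?ltW//.
    by rewrite ltr_pdivrMr// mul1r.
  apply: hd; rewrite /= sub0r normrN gtr0_norm//; apply: lt_trans zr _.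
  by near: r; exact: lt_nbhsl.
Unshelve. all: by end_near. Qed.


(** Regularity of order [k] for profiles, expressed with the operator
[G |-> G' / r]: this is the regularity up to 0 of [G] as a function of [r^2], which
makes [x |-> G |x|] of class [C^k] across the origin. *)
Fixpoint even_smooth (k : nat) (G : R -> R) : Prop := continuous G /\
  if k is k'.+1 then exists2 G1 : R -> R, even_smooth k' G1 &
    forall r, 0 < r < 1 -> is_derive r 1 G (r * G1 r)
  else True.

Lemma even_smooth_continuous k G : even_smooth k G -> continuous G.
Proof. by case: k => [|k] []. Qed.

Lemma even_smoothW k G : even_smooth k.+1 G -> even_smooth k G.
Proof.
elim: k G => [|k IH] G [Gc hG]; first by split.
have [G1 SG1 dG] := hG.
by split=> //; exists G1 => //; exact: IH.
Qed.

Lemma even_smooth_cst k (x : R) : even_smooth k (fun=> x).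
Proof.
elim: k x => [|k IH] x; split=> //; try exact: cst_continuous.
exists (fun=> 0) => // r _; rewrite mulr0; exact: is_derive1_cst.
Qed.

Lemma even_smoothD k F G : even_smooth k F -> even_smooth k G ->
  even_smooth k (fun r => F r + G r).
Proof.
elim: k F G => [|k IH] F G [Fc hF] [Gc hG]; split=> //.
- by move=> x; apply: cvgD; [exact: Fc|exact: Gc].
- by move=> x; apply: cvgD; [exact: Fc|exact: Gc].
- have [F1 SF1 dF] := hF; have [G1 SG1 dG] := hG.
  exists (fun r => F1 r + G1 r); first exact: IH.
  move=> r r01; rewrite mulrDr; exact: is_derive1_add (dF r r01) (dG r r01).
Qed.

Lemma even_smoothM k F G : even_smooth k F -> even_smooth k G ->
  even_smooth k (fun r => F r * G r).
Proof.
elim: k F G => [|k IH] F G SF SG; have [Fc hF] := SF; have [Gc hG] := SG; split=> //.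
- by move=> x; apply: cvgM; [exact: Fc|exact: Gc].
- by move=> x; apply: cvgM; [exact: Fc|exact: Gc].
- have [F1 SF1 dF] := hF; have [G1 SG1 dG] := hG.
  exists (fun r => F1 r * G r + F r * G1 r).
    by apply: even_smoothD; apply: IH => //; exact: even_smoothW.
  move=> r r01.
  by apply: is_derive1_eq (is_derive1_mul (dF r r01) (dG r r01)); ring.
Qed.

Lemma even_smoothV k G : (forall r, G r != 0) -> even_smooth k G ->
  even_smooth k (fun r => (G r)^-1).
Proof.
move=> G0; elim: k => [|k IH] SG; have [Gc hG] := SG; split=> //.
- by move=> x; apply: cvgV; [exact: G0|exact: Gc].
- by move=> x; apply: cvgV; [exact: G0|exact: Gc].
- have [G1 SG1 dG] := hG; have Gi := IH (even_smoothW SG).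
  exists (fun r => - 1 * G1 r * ((G r)^-1 * (G r)^-1)).
    apply: even_smoothM; last exact: even_smoothM.
    by apply: even_smoothM => //; exact: even_smooth_cst.
  move=> r r01; apply: is_derive1_eq (is_derive1_inv (G0 r) (dG r r01)).
  by field.
Qed.

Lemma is_derive1_ext01 f g r d : 0 < r < 1 ->
  (forall x, 0 < x < 1 -> f x = g x) ->
  is_derive r 1 f d -> is_derive r 1 g d.
Proof.
move=> /andP[r0 r1] fg; apply: near_eq_is_derive.
near=> x; apply: fg; apply/andP; split.
  by near: x; exact: lt_nbhsr.
by near: x; exact: lt_nbhsl.
Unshelve. all: by end_near. Qed.

Lemma even_smooth_ext k F G : continuous G ->
  (forall r, 0 < r < 1 -> F r = G r) -> even_smooth k F -> even_smooth k G.
Proof.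
move=> Gc FG; case: k => [|k] [Fc hF]; split=> //.
have [F1 SF1 dF] := hF; exists F1 => // r r01.
exact: (is_derive1_ext01 r01 FG (dF r r01)).
Qed.

(** Dividing the derivative of [r a' + n a = h] by [r] shows that [b = a' / r] solves
the same kind of equation with [n + 2] and [h' / r] in place of [n] and [h]. So one takes
the continuous solution [b] of that equation; the defect
[h - n a - r^2 b] multiplied by [r^n] is constant, and this constant is 0 by
continuity at 0. *)
Lemma even_smooth_solve k (n : nat) (h a : R -> R) : (0 < n)%N ->
  even_smooth k h -> continuous a ->
  (forall r, 0 < r < 1 -> is_derive r 1 a ((h r - n%:R * a r) / r)) ->
  even_smooth k a.
Proof.
elim: k n h a => [//|k IH] n h a n0 [hc [h1 Sh1 dh]] ac da; split=> //.
have [b bc db] := euler_solver (n := n.+2) isT (even_smooth_continuous Sh1).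
have Sb : even_smooth k b.
  by apply: (IH n.+2 h1) => // r /andP[r0 _]; exact: db.
exists b => // r0 r01.
suff e0 r : 0 < r < 1 -> h r - n%:R * a r - r ^+ 2 * b r = 0.
  apply: is_derive1_eq (da r0 r01); have := e0 r0 r01 => /subr0_eq ->.
  by field; case/andP: r01 => ? _; rewrite gt_eqF.
pose e r := r ^+ n * (h r - n%:R * a r - r ^+ 2 * b r).
have de (s : R) : 0 < s < 1 -> is_derive s 1 e 0.
  move=> /[dup] s01 /andP[s0 _].
  apply: is_derive1_eq (is_derive1_mul (is_derive1_exprn n s)
    (is_derive1_sub (is_derive1_sub (dh s s01) (is_derive1_cmul n%:R (da s s01)))
       (is_derive1_mul (is_derive1_exprn 2 s) (db s s0)))).
  have snE : s ^+ n = s * s ^+ n.-1 by rewrite -exprS prednK.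
  have n2E : n.+2%:R = n%:R + 2 :> R by rewrite -addn2 natrD.
  by rewrite snE n2E /=; field; rewrite gt_eqF.
have ec : e x @[x --> 0^'+] --> (0 : R).
  have := @cvg_exprn0 R n n0 => sn0.
  apply: (cvg_mul0 sn0 (l := h 0 - n%:R * a 0 - 0 ^+ 2 * b 0)).
  apply: cvg_at_right_filter; apply: cvgB.
    by apply: cvgB; [exact: hc|apply: cvgM; [exact: cvg_cst|exact: ac]].
  by apply: cvgM; [exact: exprn_continuous|exact: bc].
move=> /andP[rr0 r1].
have rn0 : r ^+ n != 0 by rewrite expf_neq0// gt_eqF.
apply: (mulfI rn0); rewrite mulr0 -/(e r); apply/eqP; rewrite eq_le; apply/andP; split.
  apply: (le_at_right0 ec rr0) => x /andP[x0 xr].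
  by apply: (derive_le0_homo de) => //; exact: ltW.
apply: (ge_at_right0 ec rr0) => x /andP[x0 xr].
by apply: (derive_ge0_homo de) => //; exact: ltW.
Qed.

(** The nonlinear iteration only makes sense on [0, 1]; precomposing with [clamp01]
turns its iterates into functions on the line to which the solver applies. *)
Definition clamp01 r : R := Num.min (Num.max r 0) 1.

Definition regular_solution (N : nat) (W a v c f : R -> R) :=
  [/\ [/\ continuous W, continuous a, continuous v & continuous c],
      W 1 = 0, a 1 = 0,
      is_derive (1 : R) 1 W 0 & radial_system N W a v c f].

(** Two successive inversions of the radial Laplacian. The additive constant in [v]
is the one that makes [a], hence the normal derivative, vanish at 1. *)
Lemma regular_solution_exists N f : (0 < N)%N -> continuous f ->
  exists W a v c, regular_solution N W a v c f.
Proof.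
move=> N0 fc.
have [c cc dc] := euler_solver N0 fc.
have idM g : continuous g -> continuous (fun r : R => r * g r).
  by move=> gc x; apply: cvgM; [exact: cvg_id|exact: gc].
have [v0 [v0c _ dv0]] := exists_primitive (idM c cc).
have [a0 a0c da0] := euler_solver N0 v0c.
pose v r := v0 r - N%:R * a0 1; pose a r := a0 r - a0 1.
have ac : continuous a by move=> x; apply: cvgB; [exact: a0c|exact: cvg_cst].
have [W [Wc W1 dW]] := exists_primitive (idM a ac).
exists W, a, v, c; split => //.
- by split=> // x; apply: cvgB; [exact: v0c|exact: cvg_cst].
- by rewrite /a subrr.
- by apply: is_derive1_eq (dW 1 ltr01); rewrite /a subrr mulr0.
- move=> r /andP[r0 _]; split.
  + exact: dW.
  + apply: is_derive1_eq (is_derive1_sub (da0 r r0) (is_derive1_cst _ r)).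
    by rewrite /a /v; field; rewrite gt_eqF.
  + by apply: is_derive1_eq (is_derive1_sub (dv0 r r0) (is_derive1_cst _ r)); rewrite subr0.
  + exact: dc.
Qed.

Lemma continuous_tame (W a v c : R -> R) : continuous W -> continuous a ->
  continuous v -> continuous c -> tame_at0 W a v c.
Proof.
have c0 n (g : R -> R) : (0 < n)%N -> continuous g ->
    r ^+ n * g r @[r --> 0^'+] --> (0 : R).
  move=> n0 gc; apply: (cvg_mul0 (cvg_exprn0 n0) (l := g 0)).
  by apply: cvg_at_right_filter; exact: gc.
move=> Wc ac vc cc; split; try exact: c0.
by exists (W 0); apply: cvg_at_right_filter; exact: Wc.
Qed.

Lemma regular_solution_tame N W a v c f :
  regular_solution N W a v c f -> tame_at0 W a v c.
Proof. by case=> -[Wc ac vc cc] _ _ _ _; exact: continuous_tame. Qed.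

Lemma regular_solution_slope N W a v c f :
  regular_solution N W a v c f -> slope_at1 W 0.
Proof. by case=> _ W1 _ dW _; exact: slope_at1_derive. Qed.

(** Each inversion of the Laplacian gains one order for [even_smooth]. *)
Lemma regular_solution_smooth k N W a v c f : (0 < N)%N ->
  regular_solution N W a v c f -> even_smooth k f ->
  even_smooth k.+1 v /\ even_smooth k.+2 W.
Proof.
move=> N0 [[Wc ac vc cc] _ _ _ S] Sf.
have Sc : even_smooth k c.
  by apply: (even_smooth_solve N0 Sf cc) => r r01; have [] := S r r01.
have Sv : even_smooth k.+1 v.
  by split=> //; exists c => // r r01; have [] := S r r01.
split=> //; split=> //; exists a; last by move=> r r01; have [] := S r r01.
by apply: (even_smooth_solve N0 Sv ac) => r r01; have [] := S r r01.
Qed.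

Lemma clamp01_itv r : 0 <= clamp01 r <= 1.
Proof. by rewrite /clamp01 ge_min lexx orbT andbT le_min ler01 le_max lexx orbT. Qed.

Lemma ge0_clamp01 g : continuous g -> (forall r, 0 < r < 1 -> 0 <= g r) ->
  forall r, 0 <= g (clamp01 r).
Proof.
move=> gc g0 r; have := clamp01_itv r; move: (clamp01 r) => {}r /andP[].
rewrite le_eqVlt => /predU1P[<- _|r0].
  have h : g x @[x --> 0^'+] --> g 0 by apply: cvg_at_right_filter; exact: gc.
  rewrite -(cvg_lim _ h)//; apply: limr_ge; first by apply/cvg_ex; exists (g 0).
  near=> x; apply: g0; apply/andP; split; first by near: x; exact: nbhs_right_gt.
  by near: x; exact: nbhs_right_lt.
rewrite le_eqVlt => /predU1P[->|r1]; last by rewrite g0// r0.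
have h : g x @[x --> 1^'-] --> g 1 by apply: cvg_at_left_filter; exact: gc.
rewrite -(cvg_lim _ h)//; apply: limr_ge; first by apply/cvg_ex; exists (g 1).
near=> x; apply: g0; apply/andP; split; first by near: x; exact: nbhs_left_gt.
by near: x; exact: nbhs_left_lt.
Unshelve. all: by end_near. Qed.

Lemma clamp01_id r : 0 < r < 1 -> clamp01 r = r.
Proof. by move=> /andP[/ltW r0 /ltW r1]; rewrite /clamp01 max_l// min_l. Qed.

Lemma clamp01_lip r s : `|clamp01 r - clamp01 s| <= `|r - s|.
Proof.
have h1 : r - s <= `|r - s| by exact: ler_norm.
have h2 : s - r <= `|r - s| by rewrite distrC ler_norm.
rewrite /clamp01 /Num.min /Num.max ler_norml.
by do !case: ifPn; rewrite -?leNgt => *; apply/andP; split; lra.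
Qed.

Lemma lipschitz_continuous M (W : R -> R) :
  (forall r s, `|W r - W s| <= M * `|r - s|) -> continuous W.
Proof.
move=> Wl r; apply/cvgrPdist_le => e e0.
have M1 : 0 < `|M| + 1 by rewrite ltr_wpDl.
near=> s; apply: le_trans (Wl r s) _.
apply: (@le_trans _ _ ((`|M| + 1) * `|r - s|)).
  by rewrite ler_wpM2r// (le_trans (ler_norm M))// lerDl.
rewrite mulrC -ler_pdivlMr//; near: s.
by apply: cvgr_dist_le; [exact: cvg_id|rewrite divr_gt0].
Unshelve. all: by end_near. Qed.

(** The clamped plate under a constant load. *)
Lemma polynomial_system (N : nat) (k : R) : (0 < N)%N ->
  radial_system N (fun r => k * (1 - r ^+ 2) ^+ 2) (fun r => - (4 * k) * (1 - r ^+ 2))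
   (fun r => 4 * k * ((N%:R + 2) * r ^+ 2 - N%:R)) (fun=> 8 * k * (N%:R + 2))
   (fun=> k * (8 * N%:R * (N%:R + 2))).
Proof.
move=> N0 r /andP[r0 _].
have d2 := is_derive1_sub (is_derive1_cst 1 r) (is_derive1_exprn 2 r).
have r_n0 : r != 0 by rewrite gt_eqF.
split.
- apply: is_derive1_eq (is_derive1_cmul k (is_derive1_mul d2 d2)).
  by rewrite /=; ring.
- by apply: is_derive1_eq (is_derive1_cmul _ d2); rewrite /=; field.
- apply: is_derive1_eq (is_derive1_cmul _ (is_derive1_sub
    (is_derive1_cmul _ (is_derive1_exprn 2 r)) (is_derive1_cst _ r))).
  by rewrite /=; ring.
- by apply: is_derive1_eq (is_derive1_cst _ r); field.
Qed.

End RadialSolver.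

(** * Solutions below supersolutions *)

Section MonotoneIteration.
Context {R : realType} (N : nat) (lam : R).
Hypotheses (N4 : (4 < N)%N) (lam0 : 0 < lam).
Implicit Types (W Z f : R -> R) (r s : R).

Let N0 : (0 < N)%N. Proof. exact: leq_trans N4. Qed.

Definition mems_rhs W r : R := lam / (1 - W r) ^+ 2.

Definition supersolution Z := exists a v c f l,
  [/\ radial_system N Z a v c f, tame_at0 Z a v c, slope_at1 Z l /\ l <= 0,
      forall r, 0 < r < 1 -> Z r < 1 &
      forall r, 0 < r < 1 -> mems_rhs Z r <= f r].

Lemma mems_rhs_le W Z r : W r <= Z r -> Z r < 1 -> mems_rhs W r <= mems_rhs Z r.
Proof.
move=> WZ Z1; rewrite /mems_rhs ler_pM2l// lef_pV2 ?posrE ?exprn_gt0 ?subr_gt0//; last first.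
  exact: le_lt_trans WZ Z1.
by rewrite ler_pXn2r ?nnegrE ?subr_ge0 ?lerB// ltW// (le_lt_trans WZ).
Qed.

Lemma mems_rhs_ge W r : 0 <= W r -> W r < 1 -> lam <= mems_rhs W r.
Proof.
move=> W0 W1; have := @mems_rhs_le (fun=> 0) W r W0 W1.
by rewrite /mems_rhs subr0 expr1n divr1.
Qed.

Lemma mems_rhs_continuous W : continuous W -> (forall r, W r < 1) ->
  continuous (mems_rhs W).
Proof.
move=> Wc W1 r; apply: cvgM; first exact: cvg_cst.
have h x : 1 - W x != 0 by rewrite subr_eq0 gt_eqF.
apply: cvgV; first by rewrite expf_neq0.
by apply: (@cvgM _ _ _ _ (fun x => 1 - W x)); apply: cvgB; by [exact: cvg_cst|exact: Wc].
Qed.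

Lemma solution_le_super f W a v c Z az vz cz fz l :
  regular_solution N W a v c f ->
  radial_system N Z az vz cz fz -> tame_at0 Z az vz cz -> slope_at1 Z l -> l <= 0 ->
  (forall r, 0 < r < 1 -> f r <= fz r) ->
  forall r, 0 < r < 1 -> az r <= a r /\ W r <= Z r.
Proof.
move=> RS SZ TZ sZ l0 fle r r01.
have SW : radial_system N W a v c f by case: RS.
have := radial_boggio N4 _ (radial_systemB SZ SW)
  (tame_at0B TZ (regular_solution_tame RS)) (slope_at1B sZ (regular_solution_slope RS)) _ r01.
rewrite subr0 subr_le0 subr_ge0; apply=> // s s01.
by rewrite subr_ge0; exact: fle.
Qed.

Let poly_k (m : R) : R := m / (8 * N%:R * (N%:R + 2)).

Let poly_kE m : poly_k m * (8 * N%:R * (N%:R + 2)) = m.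
Proof.
have Nr : 0 < (N%:R : R) by rewrite ltr0n.
by rewrite /poly_k divfK// gt_eqF// !mulr_gt0// addr_gt0.
Qed.

Let poly_regular m : exists v c, regular_solution N
  (fun r => poly_k m * (1 - r ^+ 2) ^+ 2) (fun r => - (4 * poly_k m) * (1 - r ^+ 2))
  v c (fun=> m).
Proof.
have := polynomial_system (poly_k m) N0; rewrite poly_kE => S.
have pc (p : {poly R}) (g : R -> R) : (forall r, p.[r] = g r) -> continuous g.
  by move=> /funext <-; exact: continuous_horner.
eexists; eexists; split; last exact: S.
- split.
  + by apply: (pc ((poly_k m)%:P * (1 - 'X ^+ 2) ^+ 2)) => r; rewrite !hornerE.
  + by apply: (pc ((- (4 * poly_k m))%:P * (1 - 'X ^+ 2))) => r; rewrite !hornerE.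
  + by apply: (pc ((4 * poly_k m)%:P * ((N%:R + 2)%:P * 'X ^+ 2 - N%:R%:P))) => r;
      rewrite !hornerE.
  + exact: cst_continuous.
- by rewrite expr1n subrr expr0n mulr0.
- by rewrite expr1n subrr mulr0.
- have d2 := is_derive1_sub (is_derive1_cst 1 1) (is_derive1_exprn 2 (1 : R)).
  apply: is_derive1_eq (is_derive1_cmul (poly_k m) (is_derive1_mul d2 d2)).
  by rewrite /=; ring.
Qed.

Let k_le m : 0 <= m -> 4 * poly_k m <= m.
Proof.
move=> m0; have Nr : (5 : R) <= N%:R by rewrite (ler_nat _ 5).
have k0 : 0 <= poly_k m.
  by rewrite divr_ge0// !mulr_ge0 ?addr_ge0 ?ler0n.
rewrite -{2}(poly_kE m); nra.
Qed.

(** Comparison with the two explicit solutions for the constant loads [m] and [M]. *)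
Lemma solution_bounds f W a v c (m M : R) : 0 < m -> regular_solution N W a v c f ->
  (forall r, 0 < r < 1 -> m <= f r <= M) ->
  forall r, 0 < r < 1 -> [/\ - M <= r * a r, r * a r <= 0 & 0 < W r].
Proof.
move=> m0 RS fb r /[dup] r01 /andP[r0 r1].
have Nr : (5 : R) <= N%:R by rewrite (ler_nat _ 5).
have M0 : 0 <= M.
  by have /andP[h1 h2] := fb r r01; apply: le_trans (ltW m0) (le_trans h1 h2).
have [vm [cm Rm]] := poly_regular m; have [vM [cM RM]] := poly_regular M.
have SW : radial_system N W a v c f by case: RS.
have [] := solution_le_super Rm SW (regular_solution_tame RS) (regular_solution_slope RS)
  (lexx 0) _ r01; first by move=> s /fb /andP[].
have SM : radial_system N (fun r => poly_k M * (1 - r ^+ 2) ^+ 2)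
   (fun r => - (4 * poly_k M) * (1 - r ^+ 2)) vM cM (fun=> M) by case: RM.
have [] := solution_le_super RS SM (regular_solution_tame RM) (regular_solution_slope RM)
  (lexx 0) _ r01; first by move=> s /fb /andP[].
have km0 : 0 < poly_k m by rewrite divr_gt0// !mulr_gt0 ?addr_gt0 ?ltr0n.
have kM0 : 0 <= poly_k M by rewrite divr_ge0// !mulr_ge0 ?addr_ge0 ?ler0n.
have r2 : 0 < 1 - r ^+ 2 by rewrite subr_gt0 exprn_ilt1// ltW.
have r2' : 0 < r ^+ 2 by rewrite exprn_gt0.
move=> h1 _ h2 h3; have kM := k_le M0; split.
- have : - M <= a r by apply: le_trans h1; nra.
  by move=> h; case: (lerP 0 (a r)) => ?; nra.
- by apply: mulr_ge0_le0; [exact: ltW|apply: le_trans h2 _; nra].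
- by apply: lt_le_trans h3; rewrite mulr_gt0 ?exprn_gt0.
Qed.

(** A fixed point of the order preserving operator [T] that maps [W] to the solution
with right-hand side [lam / (1 - W)^2]. By [radial_boggio], [T] preserves the set
of the [W] with [0 <= W <= kap] below both supersolutions, and by
[solution_bounds] its values are Lipschitz with a constant that does not depend
on [W]. Lipschitz functions with a common constant are stable under arbitrary
suprema, so that the Knaster-Tarski argument applies and yields at once a
continuous function, without any passage to the limit under integral signs.
Two supersolutions are needed: the singular one is the bound we are after,
the other one keeps [W] away from 1. *)
Lemma exists_solution_below (kap : R) Z1 Z2 : kap < 1 ->
  supersolution Z1 -> supersolution Z2 -> (forall r, 0 < r < 1 -> Z1 r <= kap) ->
  exists W a v c, [/\ regular_solution N W a v c (mems_rhs (W \o clamp01)),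
    even_smooth 4 W /\ even_smooth 2 v,
    forall r, 0 <= r < 1 -> 0 < W r,
    forall r, W (clamp01 r) <= kap &
    forall r, 0 < r < 1 -> W r <= Z1 r /\ W r <= Z2 r].
Proof.
move=> kap1 super1 super2 Z1kap.
have half01 : 0 < (2^-1 : R) < 1 by rewrite invr_gt0 ltr0n invf_lt1 ?ltr1n ?ltr0n.
have super_ge0 Z : supersolution Z -> forall r, 0 < r < 1 -> 0 <= Z r.
  move=> [a [v [c [f [l [S T [sl l0] _ fZ]]]]]] r r01.
  have [] // := radial_boggio N4 l0 S T sl _ r01.
  move=> s s01; apply: le_trans (fZ s s01).
  by rewrite divr_ge0 ?sqr_ge0// ltW.
have kap0 : 0 <= kap by apply: le_trans (Z1kap _ half01); exact: super_ge0 half01.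
pose M := lam / (1 - kap) ^+ 2.
pose L W := [/\ forall r, 0 <= W r <= kap, forall r s, `|W r - W s| <= M * `|r - s|,
   forall r, 0 < r < 1 -> W r <= Z1 r & forall r, 0 < r < 1 -> W r <= Z2 r].
have Lc W : L W -> continuous W.
  move=> [_ Wl _ _]; exact: lipschitz_continuous Wl.
have L1 W : L W -> forall r, W r < 1.
  by move=> [h _ _ _] r; have /andP[_ /le_lt_trans] := h r; apply.
have [T HT] : exists T : (R -> R) -> (R -> R), forall W, L W ->
    exists a v c, regular_solution N (T W) a v c (mems_rhs W).
  suff /choice[T HT] : forall W, exists T, L W -> exists a v c,
      regular_solution N T a v c (mems_rhs W) by exists T.
  move=> W; have [LW|nLW] := pselect (L W); last by exists W.
  have [T [a [v [c h]]]] := regular_solution_exists N0 (mems_rhs_continuous (Lc W LW) (L1 W LW)).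
  by exists T => _; exists a, v, c.
have memsM W : L W -> forall r, lam <= mems_rhs W r <= M.
  move=> LW r; have [h _ _ _] := LW; have /andP[h1 h2] := h r.
  rewrite mems_rhs_ge ?L1//=; exact: (mems_rhs_le (Z := fun=> kap)).
have Tc W : L W -> continuous (T W) by case/HT => a [v [c [[]]]].
have Tlesuper W Z : L W -> supersolution Z -> (forall r, 0 < r < 1 -> W r <= Z r) ->
    forall r, 0 < r < 1 -> T W r <= Z r.
  move=> LW [az [vz [cz [fz [l [S Tm [sl l0] Z_1 fZ]]]]]] WZ r r01.
  have [a [v [c RS]]] := HT W LW.
  have [] // := solution_le_super RS S Tm sl l0 _ r01 => s s01.
  by apply: le_trans (fZ s s01); apply: mems_rhs_le; [exact: WZ|exact: Z_1].
have Tmono W W' : L W -> L W' -> (forall r, W r <= W' r) ->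
    forall r, T W (clamp01 r) <= T W' (clamp01 r).
  move=> LW LW' WW' r; rewrite -subr_ge0; move: r.
  apply: (ge0_clamp01 (g := fun r => T W' r - T W r)).
    by move=> x; apply: cvgB; exact: Tc.
  move=> r r01; have [a [v [c RS]]] := HT W LW; have [a' [v' [c' RS']]] := HT W' LW'.
  have S' : radial_system N (T W') a' v' c' (mems_rhs W') by case: RS'.
  have [] := solution_le_super RS S' (regular_solution_tame RS') (regular_solution_slope RS')
    (lexx 0) _ r01; last by rewrite subr_ge0.
  by move=> s s01; apply: mems_rhs_le => //; exact: L1.
have LT W : L W -> L (T W \o clamp01).
  move=> LW; have [a [v [c RS]]] := HT W LW.
  have bnd := solution_bounds lam0 RS (fun r _ => memsM W LW r).
  have Z1T := Tlesuper W Z1 LW super1 (let: And4 _ _ h _ := LW in h).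
  have Z2T := Tlesuper W Z2 LW super2 (let: And4 _ _ _ h := LW in h).
  split.
  - move=> r; apply/andP; split.
      by apply: (ge0_clamp01 (Tc W LW)) => s s01; have [_ _ /ltW] := bnd s s01.
    rewrite /= -subr_ge0; move: r; apply: (ge0_clamp01 (g := fun r => kap - T W r)).
      by move=> x; apply: cvgB; [exact: cvg_cst|exact: Tc].
    by move=> s s01; rewrite subr_ge0; apply: le_trans (Z1T s s01) (Z1kap s s01).
  - suff Tlip r s : 0 <= r -> r <= s -> s <= 1 -> `|T W r - T W s| <= M * `|r - s|.
      have M0 : 0 <= M by rewrite divr_ge0 ?sqr_ge0// ltW.
      move=> r s; have /andP[r0 r1] := clamp01_itv r; have /andP[s0 s1] := clamp01_itv s.
      apply: le_trans (ler_wpM2l M0 (clamp01_lip r s)).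
      have [rs|sr] := leP (clamp01 r) (clamp01 s); first exact: Tlip.
      by rewrite distrC (distrC (clamp01 r)); apply: Tlip => //; exact: ltW.
    move=> r0; rewrite le_eqVlt => /predU1P[->|rs s1].
      by rewrite !subrr normr0 mulr0.
    have [z||z /[!in_itv]/= /andP[rz zs]] := @MVT R (T W) (fun r => r * a r) r s rs.
    + rewrite in_itv/= => /andP[rz zs].
      have [_ _ _ _ S] := RS; have [] // := S z.
      by rewrite (le_lt_trans r0 rz) (lt_le_trans zs s1).
    + by apply: within_continuous_for => z _; exact: Tc.
    + have z01 : 0 < z < 1 by rewrite (le_lt_trans r0 rz) (lt_le_trans zs s1).
      have [h1 h2 _] := bnd z z01 => E; rewrite distrC E normrM (distrC s) ler_wpM2r//.
      by rewrite ler_norml h1 /=; lra.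
  - by move=> r r01; rewrite /= clamp01_id//; exact: Z1T.
  - by move=> r r01; rewrite /= clamp01_id//; exact: Z2T.
(* [W0 <= T W0] because T is monotone; hence [T W0] satisfies P too and lies
   below its supremum W0. *)
pose P W := L W /\ forall r, W r <= T W (clamp01 r).
pose W0 r := sup [set W r | W in P].
have P0 : P (fun=> 0).
  have L0 : L (fun=> 0).
    split=> [r|r s|r r01|r r01].
    - by rewrite lexx.
    - by rewrite subrr normr0 mulr_ge0// divr_ge0 ?sqr_ge0// ltW.
    - exact: super_ge0 r01.
    - exact: super_ge0 r01.
  split=> // r; have [h _ _ _] := LT _ L0; by have /andP[] := h r.
have ubP r : has_sup [set W r | W in P].
  split; first by exists 0; exists (fun=> 0).
  by exists kap => _ [W [[h _ _ _] _] <-]; have /andP[] := h r.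
have W0ge W r : P W -> W r <= W0 r.
  by move=> PW; apply: sup_upper_bound => //; exists W.
have W0le r x : (forall W, P W -> W r <= x) -> W0 r <= x.
  move=> h; apply: ge_sup; first by case: (ubP r).
  by move=> _ [W PW <-]; exact: h.
have LW0 : L W0.
  split.
  - move=> r; rewrite (W0ge (fun=> 0))//=; apply: W0le => W [[h _ _ _] _].
    by have /andP[] := h r.
  - have half r s : W0 r - W0 s <= M * `|r - s|.
      rewrite lerBlDr; apply: W0le => W PW; have [[_ h _ _] _] := PW.
      rewrite -lerBlDr (le_trans _ (h r s))// (le_trans _ (ler_norm _))//.
      by rewrite lerB// W0ge.
    by move=> r s; rewrite ler_norml half andbT lerNl opprB distrC half.
  - by move=> r r01; apply: W0le => W [[_ _ h _] _]; exact: h.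
  - by move=> r r01; apply: W0le => W [[_ _ _ h] _]; exact: h.
have W0T r : W0 r <= T W0 (clamp01 r).
  apply: W0le => W PW; have [LW WT] := PW; apply: le_trans (WT r) _.
  by apply: Tmono => // s; exact: W0ge.
have TW0 r : T W0 (clamp01 r) = W0 r.
  apply/eqP; rewrite eq_le W0T andbT.
  apply: (W0ge (T W0 \o clamp01)); split; first exact: LT.
  by move=> s; apply: (Tmono _ _ LW0 (LT _ LW0)) => t; exact: W0T.
have [a [v [c RS]]] := HT W0 LW0.
have memsE : mems_rhs (T W0 \o clamp01) = mems_rhs W0.
  by apply/funext => r; rewrite /mems_rhs /= TW0.
have W0id r : 0 < r < 1 -> T W0 r = W0 r.
  by move=> r01; rewrite -TW0 clamp01_id.
have smooth_mems k : even_smooth k W0 -> even_smooth k (mems_rhs W0).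
  move=> SW; have S1 : even_smooth k (fun r => 1 + - 1 * W0 r).
    by apply: even_smoothD; [|apply: even_smoothM => //]; exact: even_smooth_cst.
  have nz r : 1 + -1 * W0 r != 0 by rewrite mulN1r subr_eq0 gt_eqF// L1.
  have SV := even_smoothV nz S1.
  have := even_smoothM (even_smooth_cst k lam) (even_smoothM SV SV).
  by apply: even_smooth_ext => [|r _]; [exact: mems_rhs_continuous (Lc _ LW0) (L1 _ LW0)
    |rewrite /mems_rhs mulN1r expr2 invfM].
(* Bootstrap: W0 is continuous, so it is of order 2, so it is of order 4. *)
have S0 : even_smooth 0 W0 by split=> //; exact: Lc.
have [_ S2] := regular_solution_smooth N0 RS (smooth_mems _ S0).
have S2' := even_smooth_ext (Lc _ LW0) W0id S2.
have [S3 S4] := regular_solution_smooth N0 RS (smooth_mems _ S2').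
have [W0kap _ W0Z1 W0Z2] := LW0.
exists (T W0), a, v, c; rewrite memsE; split=> //.
- by split=> //; exact: even_smoothW.
- have bnd := solution_bounds lam0 RS (fun r _ => memsM _ LW0 r).
  move=> r /andP[]; rewrite le_eqVlt => /predU1P[<- _|r0 r1]; last first.
    by have [] := bnd r; rewrite ?r0.
  have [_ _ W_gt0] := bnd _ half01; apply: lt_le_trans W_gt0 _.
  have Wc0 : T W0 x @[x --> 0^'+] --> T W0 0.
    by apply: cvg_at_right_filter; exact: Tc.
  have /andP[half0 half1] := half01.
  apply: (le_at_right0 Wc0 half0) => x /andP[x0 xh].
  apply: (derive_le0_homo (df := fun r => r * a r) (a := 0) (b := 1)) => //.
  + by move=> z z01; have [_ _ _ _ S1] := RS; have [] := S1 z z01.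
  + by move=> z /bnd[].
  + exact: ltW.
- by move=> r; rewrite TW0; have /andP[] := W0kap r.
- by move=> r r01; rewrite W0id//; split; [exact: W0Z1|exact: W0Z2].
Qed.

End MonotoneIteration.

(** * Differential calculus on the ball *)

Section BallCalculus.
Context {R : realType} {N : nat}.
Implicit Types (u w : 'rV[R]_N -> R) (x y v : 'rV[R]_N) (i j : 'I_N).
Local Notation e_ i := (delta_mx 0 i : 'rV[R]_N).

Lemma enorm_ge0 x : 0 <= enorm x.
Proof. exact: sqrtr_ge0. Qed.

Lemma enorm_sqr x : enorm x ^+ 2 = \sum_(i < N) x 0 i ^+ 2.
Proof. by rewrite sqr_sqrtr// sumr_ge0// => i _; exact: sqr_ge0. Qed.

Lemma enormZ (k : R) x : enorm (k *: x) = `|k| * enorm x.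
Proof.
rewrite /enorm -sqrtr_sqr -sqrtrM ?sqr_ge0//; congr Num.sqrt.
by rewrite mulr_sumr; apply: eq_bigr => i _; rewrite mxE exprMn.
Qed.

Lemma enorm0 : enorm (0 : 'rV[R]_N) = 0.
Proof. by rewrite -(scale0r 0) enormZ normr0 mul0r. Qed.

Lemma enorm_delta i : enorm (e_ i) = 1.
Proof.
rewrite /enorm (bigD1 i)//= !mxE !eqxx expr1n big1 ?addr0 ?sqrtr1// => j ji.
by rewrite !mxE eqxx (negbTE ji) expr0n.
Qed.

Lemma enorm_eq0 x : enorm x = 0 -> x = 0.
Proof.
move=> x0; apply/rowP => i; apply/eqP; rewrite mxE -sqrf_eq0.
have h : \sum_(i < N) x 0 i ^+ 2 = 0 by rewrite -enorm_sqr x0 expr0n.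
by rewrite (psumr_eq0P _ h)// => j _; exact: sqr_ge0.
Qed.

Lemma enorm_add_delta x i (t : R) :
  enorm (t *: e_ i + x) = Num.sqrt (enorm x ^+ 2 + 2 * t * x 0 i + t ^+ 2).
Proof.
rewrite enorm_sqr /enorm; congr Num.sqrt.
rewrite (bigD1 i)//= [in RHS](bigD1 i)//= !mxE !eqxx.
rewrite [X in _ + X = _](eq_bigr (fun j => x 0 j ^+ 2)) => [|j ji]; first by rewrite /=; ring.
by rewrite !mxE eqxx (negbTE ji) mulr0 add0r.
Qed.

Lemma continuous_sum (T : topologicalType) (V : normedModType R)
    (F : 'I_N -> T -> V) (x : T) :
  (forall i, {for x, continuous (F i)}) ->
  {for x, continuous (fun y : T => \sum_i F i y)}.
Proof.
move=> Fc; elim: (index_enum _) => [|i s IH].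
  have -> : (fun y : T => \sum_(i <- [::]) F i y) = fun=> 0.
    by apply/funext => y; rewrite big_nil.
  exact: cst_continuous.
have -> : (fun y : T => \sum_(j <- i :: s) F j y) =
    fun y : T => F i y + \sum_(j <- s) F j y.
  by apply/funext => y; rewrite big_cons.
by apply: cvgD; [exact: Fc|exact: IH].
Qed.

Lemma enorm_continuous : continuous (enorm : 'rV[R]_N -> R).
Proof.
move=> x; apply: (@continuous_comp _ _ _ (fun x => \sum_(i < N) x 0 i ^+ 2) Num.sqrt).
  apply: continuous_sum => i.
  by apply: (@continuous_comp _ _ _ (fun x : 'rV[R]_N => x 0 i)
    (fun t => t ^+ 2)); [exact: coord_continuous|exact: exprn_continuous].
exact: sqrt_continuous.
Qed.

Lemma uball_open : open (@uball R N).
Proof.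
have -> : @uball R N = enorm @^-1` [set r | r < 1] by [].
by apply: open_comp; [move=> x _; exact: enorm_continuous|exact: open_lt].
Qed.

Lemma near_uball x : uball x -> \forall y \near x, uball y.
Proof. by move=> bx; apply: open_nbhs_nbhs; split => //; exact: uball_open. Qed.

Lemma is_derive_uball_ext u w x v (d : R) : uball x ->
  (forall y, uball y -> u y = w y) -> is_derive x v u d -> is_derive x v w d.
Proof.
move=> bx uw; apply: near_eq_is_derive.
by apply: filterS (near_uball bx) => y; exact: uw.
Qed.

Lemma is_derive_line u x v (t d : R) :
  is_derive (t *: v + x) v u d <-> is_derive t 1 (fun s => u (s *: v + x)) d.
Proof.
have E : (fun h : R => h^-1 *: ((u \o shift (t *: v + x)) (h *: v) - u (t *: v + x))) =
   (fun h : R => h^-1 *: (((fun s => u (s *: v + x)) \o shift t) (h *: (1 : R)) -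
     u (t *: v + x))).
  apply/funext => h /=; congr (_ *: (u _ - _)).
  by rewrite [h%:A]mulr1 scalerDl addrA.
by split=> -[hd hv]; split; move: hd hv; rewrite /derivable /derive E.
Qed.

Lemma is_derive_line0 u x v (d : R) :
  is_derive x v u d <-> is_derive (0 : R) 1 (fun s => u (s *: v + x)) d.
Proof. by rewrite -is_derive_line scale0r add0r. Qed.

Lemma is_derive1_chain (f g : R -> R) (x a b : R) : is_derive (g x) 1 f a ->
  is_derive x 1 g b -> is_derive x 1 (fun t : R => f (g t)) (a * b).
Proof. by move=> fa gb; exact: is_derive1_comp. Qed.

Lemma is_derive1_sqrt_of (q : R -> R) (x d : R) : 0 < q x -> is_derive x 1 q d ->
  is_derive x 1 (fun t : R => Num.sqrt (q t)) (d / (2 * Num.sqrt (q x))).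
Proof.
move=> qx qd; apply: is_derive1_eq (is_derive1_chain (is_derive1_sqrt qx) qd).
exact: mulrC.
Qed.

Lemma is_derive_scale u x v (k d : R) : is_derive x v u d ->
  is_derive x (k *: v) u (k * d).
Proof.
move/is_derive_line0 => h; apply/is_derive_line0.
have -> : (fun s => u (s *: (k *: v) + x)) =
   (fun s => u (s *: v + x)) \o (fun s => k * s).
  by apply/funext => s /=; rewrite scalerA mulrC.
apply: is_derive1_eq (is_derive1_comp (a := d) (b := k) _ _); first exact: mulrC.
  by rewrite mulr0.
by apply: is_derive1_eq (is_derive1_cmul k (is_derive1_id 0)); rewrite mulr1.
Qed.

Lemma MVT_line (f df : R -> R) (h : R) :
  (forall t : R, `|t| <= `|h| -> is_derive t 1 f (df t)) ->
  exists2 t, `|t| <= `|h| & f h - f 0 = df t * h.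
Proof.
move=> fd.
have fc t : `|t| <= `|h| -> {for t, continuous f}.
  by move=> th; exact: is_derive1_continuous (fd t th).
have [h0|h0|->] := ltgtP h 0; last by exists 0; rewrite // subrr mulr0.
- have th t : h <= t <= 0 -> `|t| <= `|h|.
    by move=> /andP[h1 h2]; rewrite !ler0_norm ?lerN2// ltW.
  have [z||z + E] := @MVT R f df h 0 h0.
  + by rewrite in_itv /= => /andP[/ltW h1 /ltW h2]; apply: fd; apply: th; rewrite h1.
  + by apply: within_continuous_for => z hz; apply: fc; exact: th.
  + rewrite in_itv /= => /andP[/ltW h1 /ltW h2]; exists z; first by apply: th; rewrite h1.
    by move: E; lra.
- have th t : 0 <= t <= h -> `|t| <= `|h|.
    by move=> /andP[h1 h2]; rewrite !ger0_norm// (le_trans h1).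
  have [z||z + E] := @MVT R f df 0 h h0.
  + by rewrite in_itv /= => /andP[/ltW h1 /ltW h2]; apply: fd; apply: th; rewrite h1.
  + by apply: within_continuous_for => z hz; apply: fc; exact: th.
  + rewrite in_itv /= => /andP[/ltW h1 /ltW h2]; exists z; first by apply: th; rewrite h1.
    by move: E; rewrite subr0.
Qed.

(** Split the increment at [x + h v]. The mean value theorem writes the second part
as the derivative along [v'] at a point that tends to [x]. *)
Lemma is_derive_addv u x v v' (a : R) (b : 'rV[R]_N -> R) : uball x ->
  is_derive x v u a -> (forall y, uball y -> is_derive y v' u (b y)) ->
  {for x, continuous b} -> is_derive x (v + v') u (a + b x).
Proof.
move=> bx ua ub bc.
suff H : (fun h : R => h^-1 *: (u (h *: v + h *: v' + x) - u (h *: v + x)))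
    @ 0^' --> b x.
  have [ud uv] := ua.
  have ud' : (fun h : R => h^-1 *: ((u \o shift x) (h *: v) - u x)) @ 0^' --> a.
    by rewrite -uv.
  have HD : (fun h : R => h^-1 *: ((u \o shift x) (h *: (v + v')) - u x)) @ 0^' --> a + b x.
    apply: (cvg_ext (cvgD ud' H)) => // h /=.
    by rewrite -scalerDr (scalerDr h); congr (h^-1 *: _); ring.
  by split; [apply/cvg_ex; exists (a + b x)|exact: cvg_lim HD].
apply/cvgrPdist_le => e e0.
have /cvgrPdist_le /(_ _ e0) bnear := bc.
have : \forall y \near x, uball y /\ `|b x - b y| <= e.
  by near do split; [exact: near_uball|exact: bnear].
move=> /nbhs_ballP[d /= d0 hd].
have K0 : 0 < `|v| + `|v'| + 1 by rewrite ltr_wpDl ?addr_ge0.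
have inball (h t : R) : `|h| < d / (`|v| + `|v'| + 1) -> `|t| <= `|h| ->
    ball x d (t *: v' + (h *: v + x)).
  move=> hd' th; rewrite -ball_normE /ball_ /= addrA addrC opprD addrA subrr add0r normrN.
  apply: le_lt_trans (ler_normD _ _) _; rewrite !normrZ.
  rewrite ltr_pdivlMr// in hd'; apply: le_lt_trans hd'.
  have := normr_ge0 v; have := normr_ge0 v'; have := normr_ge0 h; nra.
near=> h.
have hs : `|h| < d / (`|v| + `|v'| + 1).
  near: h; apply: dnbhs0_lt; exact: divr_gt0.
have h0 : h != 0 by near: h; exact: nbhs_dnbhs_neq.
have hline (t : R) : `|t| <= `|h| -> is_derive t 1 (fun t => u (t *: v' + (h *: v + x)))
    (b (t *: v' + (h *: v + x))).
  move=> th; apply/is_derive_line; apply: ub.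
  by have [] := hd _ (inball h t hs th).
have [t th E] := MVT_line hline; rewrite scale0r add0r in E.
have -> : h *: v + h *: v' + x = h *: v' + (h *: v + x) by rewrite addrA (addrC (h *: v)).
rewrite E /GRing.scale /= mulrC mulfK//.
by have [] := hd _ (inball h t hs th).
Unshelve. all: by end_near. Qed.

(** Functions with continuous partial derivatives are differentiable along every
direction: add up the coordinate directions one at a time with
[is_derive_addv]. *)
Lemma is_derive_dir u (du : 'I_N -> 'rV[R]_N -> R) x v : uball x ->
  (forall i y, uball y -> is_derive y (e_ i) u (du i y)) ->
  (forall i y, uball y -> {for y, continuous (du i)}) ->
  is_derive x v u (\sum_i v 0 i * du i x).
Proof.
move=> bx ud dc; 
have vE : \sum_i v 0 i *: e_ i = v by rewrite {2}(matrix_sum_delta v) big_ord1.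
suff : is_derive x (\sum_i v 0 i *: e_ i) u (\sum_i v 0 i * du i x) by rewrite vE.
elim: (index_enum _) => [|i s IH]; first by rewrite !big_nil; exact: is_derive0.
rewrite !big_cons (addrC (_ *: _)) (addrC (_ * _)).
have hd y : uball y -> is_derive y (v 0 i *: e_ i) u (v 0 i * du i y).
  by move=> by'; apply: is_derive_scale; exact: ud.
have hc : {for x, continuous (fun y => v 0 i * du i y)}.
  by apply: continuousM; [exact: cst_continuous|exact: dc].
exact: (is_derive_addv bx IH hd hc).
Qed.

(** A recursive form of [Ck_ball], in which closure under products and changes of
variables is proved by induction on the order. *)
Fixpoint CK (k : nat) u : Prop := (forall x, uball x -> {for x, continuous u}) /\
  if k is k'.+1 then forall i, exists2 u', CK k' u' &
    forall x, uball x -> is_derive x (e_ i) u (u' x)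
  else True.

Lemma CK_continuous k u x : CK k u -> uball x -> {for x, continuous u}.
Proof. by case: k => [|k] [uc _]; exact: uc. Qed.

Lemma continuous_uball_ext u w x : uball x ->
  (forall y, uball y -> u y = w y) -> {for x, continuous u} -> {for x, continuous w}.
Proof.
move=> bx uw uc; rewrite /prop_for /continuous_at -(uw x bx).
apply: (cvg_near _ uc); apply: filterS (near_uball bx) => y; exact: uw.
Qed.

Lemma CK_ext k u w : (forall x, uball x -> u x = w x) -> CK k u -> CK k w.
Proof.
move=> uw; have wc : (forall x, uball x -> {for x, continuous u}) ->
    forall x, uball x -> {for x, continuous w}.
  by move=> uc x bx; apply: continuous_uball_ext bx uw (uc x bx).
case: k => [|k] [uc hu]; (split; first exact: wc) => // i.
have [u' Su' du] := hu i; exists u' => // x bx.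
exact: is_derive_uball_ext bx uw (du x bx).
Qed.

Lemma CKW k u : CK k.+1 u -> CK k u.
Proof.
elim: k u => [|k IH] u [uc hu]; split=> // i.
by have [u' /IH Su' du] := hu i; exists u'.
Qed.

Lemma CK_partial k u i : CK k.+1 u -> CK k (partial i u).
Proof.
move=> [_ hu]; have [u' Su' du] := hu i; apply: CK_ext Su' => x bx.
by have [_ <-] := du x bx.
Qed.

Lemma CK_is_derive k u i x : CK k.+1 u -> uball x -> is_derive x (e_ i) u (partial i u x).
Proof.
by move=> [_ hu] bx; have [u' _ du] := hu i; have [h _] := du x bx; exact: derivableP.
Qed.

Lemma Ck_ball_CK k u : Ck_ball k u -> CK k u.
Proof.
elim: k u => [|k IH] u Hu.
  by split=> // x bx; have [h _] := Hu x bx [::]; exact: h.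
split=> [x bx|i]; first by have [h _] := Hu x bx [::]; exact: h.
exists (partial i u).
  apply: IH => x bx s; have := Hu x bx (rcons s i).
  by rewrite size_rcons /iter_partial foldr_rcons.
move=> x bx; have [_ h] := Hu x bx [::]; apply: derivableP; exact: h.
Qed.

Lemma CK_Ck_ball k u : CK k u -> Ck_ball k u.
Proof.
move=> Hu x bx s.
have H : (size s <= k)%N -> CK (k - size s) (iter_partial s u).
  elim/last_ind: s k u Hu => [|s i IH] k u Hu; first by rewrite subn0.
  rewrite size_rcons; case: k Hu => [//|k] Hu sk.
  rewrite subSS /iter_partial foldr_rcons; apply: IH => //.
  exact: CK_partial.
split=> sk; first exact: CK_continuous (H sk) bx.
move=> i; have := H (ltnW sk).
rewrite -(subnSK sk) => h; have [] := CK_is_derive i h bx => //.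
Qed.

Lemma CK_cst k (d : R) : CK k (fun=> d).
Proof.
elim: k d => [|k IH] d; split=> //; try by move=> x _; exact: cst_continuous.
by move=> i; exists (fun=> 0) => // x _; exact: is_derive_cst.
Qed.

Lemma CK_add k u w : CK k u -> CK k w -> CK k (fun x => u x + w x).
Proof.
elim: k u w => [|k IH] u w Su Sw; have [uc hu] := Su; have [wc hw] := Sw.
  by split=> // x bx; apply: continuousD; [exact: uc|exact: wc].
split=> [x bx|i]; first by apply: continuousD; [exact: uc|exact: wc].
have [u' Su' du] := hu i; have [w' Sw' dw] := hw i.
exists (fun x => u' x + w' x); first exact: IH.
by move=> x bx; exact: is_deriveD (du x bx) (dw x bx).
Qed.

Lemma CK_mul k u w : CK k u -> CK k w -> CK k (fun x => u x * w x).
Proof.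
elim: k u w => [|k IH] u w Su Sw; have [uc hu] := Su; have [wc hw] := Sw.
  by split=> // x bx; apply: continuousM; [exact: uc|exact: wc].
split=> [x bx|i]; first by apply: continuousM; [exact: uc|exact: wc].
have [u' Su' du] := hu i; have [w' Sw' dw] := hw i.
exists (fun x => u x * w' x + w x * u' x).
  by apply: CK_add; apply: IH => //; exact: CKW.
by move=> x bx; exact: is_deriveM (du x bx) (dw x bx).
Qed.

Lemma CK_sum k (F : 'I_N -> 'rV[R]_N -> R) : (forall i, CK k (F i)) ->
  CK k (fun x => \sum_i F i x).
Proof.
move=> FC; elim: (index_enum _) => [|i s IH].
  by apply: CK_ext (CK_cst k 0) => x _; rewrite big_nil.
by apply: CK_ext (CK_add (FC i) IH) => x _; rewrite big_cons.
Qed.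

Lemma is_derive_coord x i j : is_derive x (e_ i) (fun y => y 0 j) ((i == j)%:R : R).
Proof.
apply/is_derive_line0.
have -> : (fun s : R => (s *: e_ i + x) 0 j) = fun s => s * (i == j)%:R + x 0 j.
  by apply/funext => s; rewrite !mxE eqxx /= eq_sym.
apply: is_derive1_eq (is_derive1_add (is_derive1_mul (is_derive1_id 0)
  (is_derive1_cst _ 0)) (is_derive1_cst _ 0)).
by rewrite mul1r mulr0 !addr0.
Qed.

Lemma CK_coord k j : CK k (fun x => x 0 j).
Proof.
case: k => [|k]; split=> //; try by move=> x _; exact: coord_continuous.
move=> i; exists (fun=> (i == j)%:R); first exact: CK_cst.
by move=> x _; exact: is_derive_coord.
Qed.

Lemma CK_laplacian k u : CK k.+2 u -> CK k (laplacian u).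
Proof. by move=> Su; apply: CK_sum => i; do 2 apply: CK_partial. Qed.

Lemma partial_ext u w i x : uball x -> (forall y, uball y -> u y = w y) ->
  partial i u x = partial i w x.
Proof.
move=> bx uw; apply: near_eq_derive; apply: filterS (near_uball bx) => y.
exact: uw.
Qed.

Lemma laplacian_ext u w x : uball x -> (forall y, uball y -> u y = w y) ->
  laplacian u x = laplacian w x.
Proof.
move=> bx uw; apply: eq_bigr => i _; apply: partial_ext => // y by'.
exact: partial_ext.
Qed.

Lemma enorm_mulmx (M : 'M[R]_N) x : M *m M^T = 1%:M -> enorm (x *m M) = enorm x.
Proof.
have dot (z : 'rV[R]_N) : \sum_(i < N) z 0 i ^+ 2 = (z *m z^T) 0 0 :> R.
  by rewrite mxE; apply: eq_bigr => i _; rewrite mxE.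
by move=> MM; rewrite /enorm !dot trmx_mul mulmxA -(mulmxA x) MM mulmx1.
Qed.

Lemma mulmx_continuous (M : 'M[R]_N) : continuous (fun x : 'rV[R]_N => x *m M).
Proof.
move=> x.
have -> : (fun x : 'rV[R]_N => x *m M) = fun x => \sum_i x 0 i *: row i M.
  by apply/funext => y; rewrite mulmx_sum_row.
apply: continuous_sum => i; apply: continuousZr_tmp; exact: coord_continuous.
Qed.

Lemma is_derive_mulmx (M : 'M[R]_N) u k x i : M *m M^T = 1%:M -> CK k.+1 u -> uball x ->
  is_derive x (e_ i) (fun y => u (y *m M)) (\sum_j M i j * partial j u (x *m M)).
Proof.
move=> MM Su bx; apply/is_derive_line0.
have -> : (fun s : R => u ((s *: e_ i + x) *m M)) = fun s => u (s *: (e_ i *m M) + x *m M).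
  by apply/funext => s; rewrite mulmxDl scalemxAl.
apply/is_derive_line0; have bxM : uball (x *m M) by rewrite /uball /= enorm_mulmx.
rewrite (eq_bigr (fun j => (e_ i *m M) 0 j * partial j u (x *m M))) => [|j _].
  have h1 j y (by' : uball y) := CK_is_derive j Su by'.
  have h2 j y (by' : uball y) := CK_continuous (CK_partial j Su) by'.
  exact: (is_derive_dir _ bxM h1 h2).
by rewrite -rowE mxE.
Qed.

Lemma CK_mulmx k (M : 'M[R]_N) u : M *m M^T = 1%:M -> CK k u ->
  CK k (fun y => u (y *m M)).
Proof.
move=> MM; elim: k u => [|k IH] u Su.
  split=> // x bx; apply: (@continuous_comp _ _ _ (fun y => y *m M) u).
    exact: mulmx_continuous.
  by apply: CK_continuous Su _; rewrite /uball /= enorm_mulmx.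
split=> [x bx|i].
  apply: (@continuous_comp _ _ _ (fun y => y *m M) u); first exact: mulmx_continuous.
  by apply: CK_continuous Su _; rewrite /uball /= enorm_mulmx.
exists (fun y => \sum_j M i j * partial j u (y *m M)).
  apply: CK_sum => j; apply: CK_mul; first exact: CK_cst.
  by apply: IH; exact: CK_partial.
by move=> x bx; exact: is_derive_mulmx MM Su bx.
Qed.

Lemma is_derive_sum_ord (F : 'I_N -> 'rV[R]_N -> R) (d : 'I_N -> R) x v :
  (forall i, is_derive x v (F i) (d i)) ->
  is_derive x v (fun y => \sum_i F i y) (\sum_i d i).
Proof.
move=> Fd; have -> : (fun y => \sum_i F i y) = \sum_i F i.
  by apply/funext => y; rewrite fct_sumE.
exact: is_derive_sum.
Qed.

(** The second derivatives of [u (y M)] are the entries of [M H M^T], where [H] is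
the matrix of second derivatives of [u] at [x M], and the trace does not see the
orthogonal matrix [M]. *)
Lemma laplacian_mulmx (M : 'M[R]_N) u x : M *m M^T = 1%:M -> CK 2 u -> uball x ->
  laplacian (fun y => u (y *m M)) x = laplacian u (x *m M).
Proof.
move=> MM Su bx.
have pE i y : uball y -> partial i (fun y => u (y *m M)) y =
    \sum_j M i j * partial j u (y *m M).
  by move=> by'; have [_ <-] := is_derive_mulmx i MM Su by'.
have ppE i : partial i (partial i (fun y => u (y *m M))) x =
    \sum_j M i j * \sum_l M i l * partial l (partial j u) (x *m M).
  rewrite (partial_ext i bx (pE i)).
  suff [_ <-] : is_derive x (e_ i) (fun y => \sum_j M i j * partial j u (y *m M))
    (\sum_j M i j * \sum_l M i l * partial l (partial j u) (x *m M)) by [].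
  apply: is_derive_sum_ord => j.
  exact: is_deriveZ (is_derive_mulmx i MM (CK_partial j Su) bx).
have MM' : M^T *m M = 1%:M by exact: mulmx1C.
transitivity (\sum_i \sum_j M i j * \sum_l M i l * partial l (partial j u) (x *m M)).
  by apply: eq_bigr => i _; exact: ppE.
under eq_bigr => i _ do under eq_bigr => j _ do rewrite mulr_sumr.
rewrite exchange_big /=; apply: eq_bigr => j _.
rewrite exchange_big /= (bigD1 j)//= [X in _ + X]big1 ?addr0 => [|l lj].
  under eq_bigr do rewrite mulrA.
  rewrite -mulr_suml.
  have -> : \sum_i M i j * M i j = (M^T *m M) j j.
    by rewrite mxE; apply: eq_bigr => i _; rewrite mxE.
  by rewrite MM' mxE eqxx mul1r.
under eq_bigr do rewrite mulrA.
rewrite -mulr_suml.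
have -> : \sum_i M i j * M i l = (M^T *m M) j l.
  by rewrite mxE; apply: eq_bigr => i _; rewrite mxE.
by rewrite MM' mxE eq_sym (negbTE lj) mul0r.
Qed.

(** The reflection in the hyperplane orthogonal to [x - y]. *)
Lemma householder x y : enorm x = enorm y ->
  exists2 M : 'M[R]_N, M *m M^T = 1%:M & x *m M = y.
Proof.
have dot (z : 'rV[R]_N) : enorm z ^+ 2 = (z *m z^T) 0 0.
  by rewrite enorm_sqr mxE; apply: eq_bigr => i _; rewrite mxE.
move=> xy; have [->|nxy] := eqVneq x y.
  by exists 1%:M; rewrite ?trmx1 ?mulmx1.
pose n := x - y; pose q := (n *m n^T) 0 0.
have q0 : q != 0.
  rewrite /q -dot expf_neq0//; apply: contra_neq nxy => /enorm_eq0 /eqP.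
  by rewrite subr_eq0 => /eqP.
have nn : n *m n^T = q%:M by rewrite [LHS]mx11_scalar.
have xn : x *m n^T = (q / 2)%:M.
  rewrite [LHS]mx11_scalar; congr (_%:M).
  have cm : (x *m y^T) 0 0 = (y *m x^T) 0 0.
    by rewrite !mxE; apply: eq_bigr => i _; rewrite !mxE mulrC.
  have e1 : (x *m x^T) 0 0 = (y *m y^T) 0 0 by rewrite -!dot xy.
  have -> : (x *m n^T) 0 0 = (x *m x^T) 0 0 - (x *m y^T) 0 0.
    by rewrite /n linearB /= mulmxBr !mxE.
  have -> : q = (x *m x^T) 0 0 - (x *m y^T) 0 0 - ((y *m x^T) 0 0 - (y *m y^T) 0 0).
    by rewrite /q /n linearB /= mulmxBr !mulmxBl !mxE; ring.
  by rewrite -e1 -cm; field.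
have PP : (n^T *m n) *m (n^T *m n) = q *: (n^T *m n).
  by rewrite mulmxA -(mulmxA n^T n) nn mul_mx_scalar -scalemxAl.
have PT : (n^T *m n)^T = n^T *m n by rewrite trmx_mul trmxK.
have xP : x *m (n^T *m n) = (q / 2) *: n by rewrite mulmxA xn mul_scalar_mx.
move: (n^T *m n) PP PT xP => P PP PT xP.
exists (1%:M - (2 / q) *: P).
  have -> : (1%:M - (2 / q) *: P)^T = 1%:M - (2 / q) *: P.
    by rewrite linearB /= trmx1 linearZ /= PT.
  rewrite mulmxBl mul1mx -scalemxAl mulmxBr mulmx1 -scalemxAr PP scalerBr !scalerA.
  have -> : 2 / q * (2 / q) * q = 2 / q + 2 / q by field.
  by rewrite scalerDl opprB addrK subrK.
rewrite mulmxBr mulmx1 -scalemxAr xP scalerA.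
have -> : 2 / q * (q / 2) = 1 by field.
by rewrite scale1r /n opprB addrCA subrr addr0.
Qed.

Definition radial_on_ball u := forall x y, uball x -> uball y -> enorm x = enorm y ->
  u x = u y.

Lemma radial_laplacian u : CK 2 u -> radial_on_ball u -> radial_on_ball (laplacian u).
Proof.
move=> Su ru x y bx by' xy; have [M MM <-] := householder xy.
rewrite -(laplacian_mulmx MM Su bx); apply: laplacian_ext => // z bz.
by apply: ru => //; rewrite /uball /= ?enorm_mulmx.
Qed.


(** * Radial functions and their profiles *)

Implicit Types (r s t h : R).
Section Ray.
Variable i0 : 'I_N.

Definition on_ray (r : R) : 'rV[R]_N := r *: e_ i0.
Local Notation ray := on_ray.

Lemma enorm_ray r : enorm (ray r) = `|r|.
Proof. by rewrite enormZ enorm_delta mulr1. Qed.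

Lemma uball_ray r : uball (ray r) <-> `|r| < 1.
Proof. by rewrite /uball /= enorm_ray. Qed.

Lemma radial_ray u x : radial_on_ball u -> uball x -> u x = u (ray (enorm x)).
Proof.
have E : enorm (ray (enorm x)) = enorm x by rewrite enorm_ray ger0_norm ?enorm_ge0.
by move=> ru bx; apply: ru => //; rewrite /uball /= E.
Qed.

Lemma ray_continuous : continuous ray.
Proof. by move=> r; apply: continuousZr_tmp; exact: cvg_id. Qed.

Lemma is_derive_ray u r d : is_derive (ray r) (e_ i0) u d ->
  is_derive r 1 (fun s => u (ray s)) d.
Proof.
move=> h; have : is_derive r 1 (fun s : R => u (s *: e_ i0 + 0)) d.
  by apply/is_derive_line; rewrite addr0.
by have -> : (fun s : R => u (s *: e_ i0 + 0)) = fun s => u (ray s)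
  by apply/funext => s; rewrite addr0.
Qed.

(** Across the ray [u] is a function of [rho h = sqrt (r^2 + h^2)], so its partial
derivative in the transverse direction is [h * k h] with [k] continuous; the
derivative of that product at 0 is [k 0]. *)
Lemma radial_second_partial u (i : 'I_N) r : CK 2 u -> radial_on_ball u -> i != i0 ->
  0 < r < 1 -> partial i (partial i u) (ray r) = partial i0 u (ray r) / r.
Proof.
move=> Su ru ii0 /andP[r0 r1].
have ray_i s : (ray s) 0 i = 0 by rewrite !mxE eqxx (negbTE ii0) mulr0.
have enE (h s : R) : enorm (h *: e_ i + ray s) = Num.sqrt (s ^+ 2 + h ^+ 2).
  rewrite enorm_add_delta enorm_ray ray_i; congr Num.sqrt.
  by rewrite real_normK ?num_real//; ring.
pose rho (h : R) : R := Num.sqrt (r ^+ 2 + h ^+ 2).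
have rho0 h : 0 < rho h by rewrite sqrtr_gt0 ltr_pwDl ?sqr_ge0 ?exprn_gt0.
have rhoc : continuous rho.
  move=> h; apply: (@continuous_comp _ _ _ (fun h => r ^+ 2 + h ^+ 2) Num.sqrt).
    by apply: cvgD; [exact: cvg_cst|exact: exprn_continuous].
  exact: sqrt_continuous.
have rho00 : rho 0 = r by rewrite /rho expr0n addr0 sqrtr_sqr gtr0_norm.
have near1 : \forall h \near (0 : R), rho h < 1.
  have /cvgr_lt := rhoc 0; apply; by rewrite rho00.
pose k h := partial i0 u (ray (rho h)) / rho h.
have kc : {for (0 : R), continuous k}.
  apply: continuousM.
    apply: (@continuous_comp _ _ _ rho (fun s => partial i0 u (ray s))); first exact: rhoc.
    apply: (@continuous_comp _ _ _ ray (partial i0 u)); first exact: ray_continuous.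
    apply: CK_continuous (CK_partial i0 Su) _.
    by apply/uball_ray; rewrite rho00 gtr0_norm.
  by apply: continuousV; [rewrite gt_eqF|exact: rhoc].
have pE h : rho h < 1 -> partial i u (h *: e_ i + ray r) = h * k h.
  move=> h1.
  suff [_ //] : is_derive (h *: e_ i + ray r) (e_ i) u (h * k h).
  apply/is_derive_line.
  have bh : uball (h *: e_ i + ray r) by rewrite /uball /= enE.
  have Ud : is_derive (rho h) 1 (fun s => u (ray s)) (partial i0 u (ray (rho h))).
    apply: is_derive_ray; apply: CK_is_derive Su _.
    by apply/uball_ray; rewrite gtr0_norm.
  have qd : is_derive h 1 (fun t : R => r ^+ 2 + t ^+ 2) (2 * h).
    apply: is_derive1_eq (is_derive1_add (is_derive1_cst _ h)
      (is_derive1_exprn 2 h)).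
    by rewrite add0r.
  have qh : 0 < r ^+ 2 + h ^+ 2 by rewrite ltr_pwDl ?sqr_ge0 ?exprn_gt0.
  have cd := is_derive1_chain (g := rho) Ud (is_derive1_sqrt_of
    (q := fun t => r ^+ 2 + t ^+ 2) qh qd).
  apply: (near_eq_is_derive (f := fun s => u (ray (rho s)))).
    have /cvgr_lt /(_ _ h1) := rhoc h.
    apply: filterS => s s1 /=.
    rewrite [RHS](radial_ray ru) ?enE//.
    by rewrite /uball /= enE.
  apply: is_derive1_eq cd; rewrite /k -/(rho h).
  by field; rewrite gt_eqF.
suff [_ E] : is_derive (ray r) (e_ i) (partial i u) (k 0).
  by rewrite {1}/partial E /k rho00.
apply/is_derive_line0.
apply: (near_eq_is_derive (f := fun h => h * k h)).
  by apply: filterS near1 => h /pE ->.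
have H : (fun h : R => h^-1 *: (((fun h => h * k h) \o shift 0) (h *: (1 : R)) -
    0 * k 0)) @ 0^' --> k 0.
  have kc' : k h @[h --> 0^'] --> k 0 by apply/continuous_withinNx.
  apply: (cvg_near _ kc'); near=> h.
  have h0 : h != 0 by near: h; exact: nbhs_dnbhs_neq.
  by rewrite /= [h%:A]mulr1 addr0 mul0r subr0 /GRing.scale /= mulKf.
by split; [apply/cvg_ex; exists (k 0)|exact: cvg_lim H].
Unshelve. all: by end_near. Qed.

(** Adding the [N - 1] transverse second derivatives to the one along the ray gives
the radial form of the Laplacian. *)
Lemma radial_profile u r : CK 2 u -> radial_on_ball u -> 0 < r < 1 ->
  is_derive r 1 (fun s => u (ray s)) (r * (partial i0 u (ray r) / r)) /\
  is_derive r 1 (fun s => partial i0 u (ray s) / s)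
    ((laplacian u (ray r) - N%:R * (partial i0 u (ray r) / r)) / r).
Proof.
move=> Su ru /[dup] r01 /andP[r0 r1].
have br : uball (ray r) by apply/uball_ray; rewrite gtr0_norm.
have rn0 : r != 0 by rewrite gt_eqF.
split.
  have := is_derive_ray (CK_is_derive i0 Su br); apply: is_derive1_eq.
  by rewrite mulrC divfK.
have lapE : laplacian u (ray r) = partial i0 (partial i0 u) (ray r) +
    (N%:R - 1) * (partial i0 u (ray r) / r).
  rewrite /laplacian (bigD1 i0)//=; congr (_ + _).
  rewrite (eq_bigr (fun=> partial i0 u (ray r) / r)) => [|i ii0]; last first.
    exact: radial_second_partial.
  rewrite (eq_bigl (fun i => i \in predC1 i0)) // sumr_const cardC1 card_ord.
  by rewrite -[LHS]mulr_natl -subn1 natrB// (leq_ltn_trans _ (ltn_ord i0)).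
have Dd := is_derive_ray (CK_is_derive i0 (CK_partial i0 Su) br).
apply: is_derive1_eq (is_derive1_mul Dd (is_derive1_inv rn0 (is_derive1_id r))).
by rewrite lapE; field.
Qed.

End Ray.

(** At the origin the chain rule through [enorm] is not available; there the mean
value theorem and [G' = r G1] show that the derivative is 0. *)
Lemma is_derive_lift (G G1 : R -> R) x i : continuous G -> continuous G1 ->
  (forall r, 0 < r < 1 -> is_derive r 1 G (r * G1 r)) -> uball x ->
  is_derive x (e_ i) (fun y => G (enorm y)) (x 0 i * G1 (enorm x)).
Proof.
move=> Gc G1c dG bx; apply/is_derive_line0.
have [x0|x0] := eqVneq (enorm x) 0.
  rewrite (enorm_eq0 x0) mxE mul0r.
  have -> : (fun s : R => G (enorm (s *: e_ i + 0))) = fun s : R => G `|s|.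
    by apply/funext => s; rewrite addr0 enormZ enorm_delta mulr1.
  have H : (fun h : R => h^-1 *: (((fun s : R => G `|s|) \o shift 0)
      (h *: (1 : R)) - G `|(0 : R)|)) @ 0^' --> (0 : R).
    apply/cvgrPdist_le => e e0.
    have K : (fun r => r * G1 r) @ (0 : R) --> 0 * G1 0.
      by apply: cvgM; [exact: cvg_id|exact: G1c].
    rewrite mul0r in K; have /cvgrPdist_le /(_ _ e0) [/= d d0 hd] := K.
    near=> h.
    have h0 : h != 0 by near: h; exact: nbhs_dnbhs_neq.
    have hd' : `|h| < d by near: h; exact: dnbhs0_lt.
    have h1 : `|h| < 1 by near: h; exact: dnbhs0_lt.
    rewrite /= [h%:A]mulr1 addr0 normr0 sub0r normrN.
    have hp : 0 < `|h| by rewrite normr_gt0.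
    have [z||z + E] := @MVT R G (fun r => r * G1 r) 0 `|h| hp.
    - by rewrite in_itv /= => /andP[z0 zh]; apply: dG; rewrite z0 (lt_trans zh).
    - by apply: within_continuous_for => z _; exact: Gc.
    - rewrite in_itv /= => /andP[z0 zh].
      rewrite E subr0 /GRing.scale /= !normrM normr_id normfV mulrCA mulVf ?normr_eq0// mulr1.
      rewrite -normrM; have := hd z; rewrite /= !sub0r !normrN gtr0_norm//.
      by apply; exact: lt_trans hd'.
  by split; [apply/cvg_ex; exists 0|exact: cvg_lim H].
have r0 : 0 < enorm x by rewrite lt_neqAle eq_sym x0 enorm_ge0.
have -> : (fun s : R => G (enorm (s *: e_ i + x))) =
   fun s => G (Num.sqrt (enorm x ^+ 2 + 2 * s * x 0 i + s ^+ 2)).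
  by apply/funext => s /=; rewrite enorm_add_delta.
have qd : is_derive (0 : R) 1
    (fun s : R => enorm x ^+ 2 + 2 * s * x 0 i + s ^+ 2) (2 * x 0 i).
  apply: is_derive1_eq (is_derive1_add (is_derive1_add (is_derive1_cst _ 0)
    (is_derive1_mul (is_derive1_cmul 2 (is_derive1_id 0)) (is_derive1_cst (x 0 i) 0)))
    (is_derive1_exprn 2 0)).
  by rewrite /= expr1; ring.
have q0 : enorm x ^+ 2 + 2 * 0 * x 0 i + 0 ^+ 2 = enorm x ^+ 2.
  by rewrite expr0n mulr0 mul0r !addr0.
have qp : 0 < enorm x ^+ 2 + 2 * 0 * x 0 i + 0 ^+ 2 by rewrite q0 exprn_gt0.
have rd := is_derive1_sqrt_of
  (q := fun s => enorm x ^+ 2 + 2 * s * x 0 i + s ^+ 2) qp qd.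
have sE : Num.sqrt (enorm x ^+ 2 + 2 * 0 * x 0 i + 0 ^+ 2) = enorm x.
  by rewrite q0 sqrtr_sqr gtr0_norm.
have Gd : is_derive (Num.sqrt (enorm x ^+ 2 + 2 * 0 * x 0 i + 0 ^+ 2)) 1 G
    (enorm x * G1 (enorm x)).
  by rewrite sE; apply: dG; rewrite r0.
apply: is_derive1_eq (is_derive1_chain (g := fun s : R =>
  Num.sqrt (enorm x ^+ 2 + 2 * s * x 0 i + s ^+ 2)) Gd rd).
by rewrite sE; field.
Unshelve. all: by end_near. Qed.

Lemma CK_lift k G : even_smooth k G -> CK k (fun x => G (enorm x)).
Proof.
have cont (F : R -> R) : continuous F -> forall x, uball x ->
    {for x, continuous (fun y : 'rV[R]_N => F (enorm y))}.
  move=> Fc x _; apply: (@continuous_comp _ _ _ enorm F); last exact: Fc.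
  exact: enorm_continuous.
elim: k G => [|k IH] G [Gc hG]; (split; first exact: cont) => // i.
have [G1 SG1 dG] := hG; exists (fun x => x 0 i * G1 (enorm x)).
  by apply: CK_mul; [exact: CK_coord|exact: IH].
by move=> x bx; apply: is_derive_lift => //; exact: even_smooth_continuous SG1.
Qed.

Lemma eq_at0 (f g : R -> R) : continuous f -> continuous g ->
  (forall r, 0 < r < 1 -> f r = g r) -> f 0 = g 0.
Proof.
move=> fc gc fg.
have hf : f x @[x --> 0^'+] --> f 0 by apply: cvg_at_right_filter; exact: fc.
have hg : g x @[x --> 0^'+] --> g 0 by apply: cvg_at_right_filter; exact: gc.
have hf' : g x @[x --> 0^'+] --> f 0.
  apply: (cvg_near _ hf); near=> r; apply: fg; apply/andP; split.
    by near: r; exact: nbhs_right_gt.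
  by near: r; exact: nbhs_right_lt.
exact: cvg_unique hf' hg.
Unshelve. all: by end_near. Qed.

(** The given [a] and the quotient [W' / r] provided by [even_smooth] agree away from
0. The identity at the centre of the ball follows by continuity. *)
Lemma laplacian_lift (W a v : R -> R) x : even_smooth 2 W -> continuous v ->
  (forall r, 0 < r < 1 -> is_derive r 1 W (r * a r)) ->
  (forall r, 0 < r < 1 -> is_derive r 1 a ((v r - N%:R * a r) / r)) ->
  uball x -> laplacian (fun y => W (enorm y)) x = v (enorm x).
Proof.
move=> [Wc [W1 [W1c [W2 [W2c _] dW1]] dW]] vc da' db bx.
have pE i y : uball y -> partial i (fun y => W (enorm y)) y = y 0 i * W1 (enorm y).
  by move=> by'; have [_ <-] := is_derive_lift i Wc W1c dW by'.
have ppE i : partial i (partial i (fun y => W (enorm y))) x =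
    W1 (enorm x) + x 0 i ^+ 2 * W2 (enorm x).
  rewrite (partial_ext i bx (pE i)).
  have [_ E] : is_derive x (e_ i) (fun y => y 0 i * W1 (enorm y)) _ :=
    is_deriveM (is_derive_coord x i i) (is_derive_lift i W1c W2c dW1 bx).
  by rewrite /partial E eqxx /GRing.scale /=; ring.
have -> : laplacian (fun y => W (enorm y)) x =
    N%:R * W1 (enorm x) + enorm x ^+ 2 * W2 (enorm x).
  rewrite enorm_sqr /laplacian.
  rewrite (eq_bigr (fun i => W1 (enorm x) + x 0 i ^+ 2 * W2 (enorm x)))
    => [|i _]; last exact: ppE.
  by rewrite big_split /= sumr_const card_ord mulr_natl mulr_suml.
have E r : 0 < r < 1 -> N%:R * W1 r + r ^+ 2 * W2 r = v r.
  move=> /[dup] r01 /andP[r0 r1]; have rn0 : r != 0 by rewrite gt_eqF.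
  have aE s : 0 < s < 1 -> W1 s = a s.
    move=> /[dup] s01 /andP[s0 _].
    have [_ e1] := dW s s01; have [_ e2] := da' s s01.
    have sn0 : s != 0 by rewrite gt_eqF.
    by apply: (mulfI sn0); rewrite -e1 -e2.
  have [_ e2] := dW1 r r01.
  have [_ e1] := is_derive1_ext01 r01 (fun s hs => esym (aE s hs)) (db r r01).
  have : r * W2 r = (v r - N%:R * a r) / r by rewrite -e1 -e2.
  move=> h; rewrite expr2 -mulrA h (aE r r01); field.
  exact: rn0.
have [x0|x0] := eqVneq (enorm x) 0.
  rewrite x0; apply: (eq_at0 (f := fun r => N%:R * W1 r + r ^+ 2 * W2 r)) => //.
  move=> r; apply: cvgD; apply: cvgM;
    [exact: cvg_cst|exact: W1c|exact: exprn_continuous|exact: W2c].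
by apply: E; rewrite lt_neqAle eq_sym x0 enorm_ge0.
Qed.

End BallCalculus.

(** * Comparison of classical solutions with the barrier *)

Section Solutions.
Context {R : realType} {N : nat}.
Implicit Types (u w : 'rV[R]_N -> R) (x y : 'rV[R]_N) (r : R).

Lemma within_ucball_mulmx (M : 'M[R]_N) u : M *m M^T = 1%:M ->
  {within ucball, continuous u} -> {within ucball, continuous (fun x => u (x *m M))}.
Proof.
move=> MM /subspace_continuousP uc; apply/subspace_continuousP => x bx.
have bxM : ucball (x *m M) by rewrite /ucball /= enorm_mulmx.
move=> P /(uc _ bxM) H.
have H' : \forall y \near x, ucball (y *m M) -> P (u (y *m M)).
  exact: (@mulmx_continuous R N M x _ H).
suff : \forall y \near x, ucball y -> P (u (y *m M)) by [].
apply: filterS H' => y hy by'; apply: hy.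
by rewrite /ucball /= enorm_mulmx.
Qed.

Lemma classical_solution_mulmx (M : 'M[R]_N) lam u : M *m M^T = 1%:M ->
  classical_solution lam u -> classical_solution lam (fun x => u (x *m M)).
Proof.
move=> MM [[u4 [u1 uc ug]] ubi u01 ubd].
have S4 := Ck_ball_CK u4.
have ball_mulmx x : uball x -> uball (x *m M) by rewrite /uball /= enorm_mulmx.
split.
- split; first exact/CK_Ck_ball/CK_mulmx.
  split; first exact/CK_Ck_ball/CK_mulmx/Ck_ball_CK.
    exact: within_ucball_mulmx.
  have /choice[g hg] : forall j, exists g : 'rV[R]_N -> R,
    {within ucball, continuous g} /\ forall x, uball x -> g x = partial j u x.
    by move=> j; have [g gc gE] := ug j; exists g.
  move=> i; exists (fun x => \sum_j M i j * g j (x *m M)).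
    move=> x; apply: continuous_sum => j; apply: continuousM; first exact: cst_continuous.
    by have [gc _] := hg j; exact: within_ucball_mulmx gc x.
  move=> x bx; have [_] := is_derive_mulmx i MM S4 bx; rewrite /partial => ->.
  by apply: eq_bigr => j _; have [_ ->] := hg j; [|exact: ball_mulmx].
- move=> x bx; rewrite -ubi; last exact: ball_mulmx.
  have S2 : CK 2 u by do 2 apply: CKW.
  rewrite /bilaplacian.
  transitivity (laplacian (fun y => laplacian u (y *m M)) x).
    by apply: (laplacian_ext bx) => y by'; exact: (laplacian_mulmx MM S2 by').
  exact: (laplacian_mulmx MM (CK_laplacian S4) bx).
- by move=> x bx; apply: u01; exact: ball_mulmx.
- move=> x sx; have [|u0 un] := ubd (x *m M); first by rewrite /usphere /= enorm_mulmx.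
  split=> //; move: un; rewrite /has_normal_derivative.
  by under eq_fun do rewrite scalemxAl -mulmxDl.
Qed.

(** Composing with the reflection that exchanges two points of the same norm gives
another classical solution, which cannot be smaller. *)
Lemma minimal_solution_radial lam u : minimal_solution lam u -> radial_on_ball u.
Proof.
move=> [uS umin].
have le x y : uball x -> enorm x = enorm y -> u x <= u y.
  move=> bx xy; have [M MM <-] := householder xy.
  exact: (umin _ (classical_solution_mulmx MM uS)).
by move=> x y bx by' xy; apply/eqP; rewrite eq_le !le.
Qed.

Section Profile.
Variable i0 : 'I_N.
Local Notation ray := (on_ray (R := R) i0).

Lemma classical_profile lam u : classical_solution lam u -> radial_on_ball u ->
  let a r := partial i0 u (ray r) / r in
  let c r := partial i0 (laplacian u) (ray r) / r in
  [/\ radial_system N (fun r => u (ray r)) a (fun r => laplacian u (ray r)) c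
        (mems_rhs lam (fun r => u (ray r))),
      tame_at0 (fun r => u (ray r)) a (fun r => laplacian u (ray r)) c,
      slope_at1 (fun r => u (ray r)) 0 &
      u (ray r) @[r --> 0^'+] --> u 0].
Proof.
move=> [[u4 _] ubi u01 ubd] ru a c; have S4 := Ck_ball_CK u4.
have S2 : CK 2 u by do 2 apply: CKW.
have SL := CK_laplacian S4; have rl := radial_laplacian S2 ru.
have ray0 : ray 0 = 0 by rewrite /on_ray scale0r.
have b0 : uball (0 : 'rV[R]_N) by rewrite /uball /= enorm0.
have at0 w : {for 0, continuous w} -> w (ray r) @[r --> 0^'+] --> w 0.
  move=> wc; have h : {for 0, continuous (fun r => w (ray r))}.
    by apply: (@continuous_comp _ _ _ ray w); [exact: ray_continuous|rewrite ray0].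
  by rewrite /prop_for /continuous_at ray0 in h; exact: cvg_at_right_filter.
have tame n w : (0 < n)%N -> {for 0, continuous w} ->
    r ^+ n * w (ray r) @[r --> 0^'+] --> (0 : R).
  by move=> n0 /at0; exact: cvg_mul0 (cvg_exprn0 n0).
have uc0 : {for 0, continuous u} by exact: CK_continuous S4 b0.
have div n w : (1 < n)%N -> {for 0, continuous w} ->
    r ^+ n * (w (ray r) / r) @[r --> 0^'+] --> (0 : R).
  move=> n1 wc; have n0 : (0 < n.-1)%N by rewrite -subn1 subn_gt0.
  apply: (cvg_near _ (tame _ _ n0 wc)); near=> r.
  have r0 : r != 0 by rewrite gt_eqF//; near: r; exact: nbhs_right_gt.
  by rewrite -{2}(prednK (ltnW n1)) exprS; field.
split.
- move=> r /[dup] r01 /andP[r0 r1].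
  have br : uball (ray r) by apply/uball_ray; rewrite gtr0_norm.
  have [h1 h2] := radial_profile i0 S2 ru r01.
  have [h3 h4] := radial_profile i0 SL rl r01.
  by split => //; rewrite /mems_rhs -ubi.
- split; first by exists (u 0); exact: at0.
  + by apply: div => //; exact: CK_continuous (CK_partial i0 S2) b0.
  + by apply: tame => //; exact: CK_continuous SL b0.
  + by apply: div => //; exact: CK_continuous (CK_partial i0 SL) b0.
- have s1 : usphere (ray 1) by rewrite /usphere /= enorm_ray normr1.
  have [u0 un] := ubd _ s1; apply: (cvg_ext un) => // h.
  by rewrite u0 subr0 mulrC /on_ray scale1r scalerDl scale1r.
- exact: at0.
Unshelve. all: by end_near. Qed.

End Profile.

Lemma lift_classical_solution lam kap (W a v c : R -> R) : (0 < N)%N -> kap < 1 ->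
  regular_solution N W a v c (mems_rhs lam (W \o @clamp01 R)) ->
  even_smooth 4 W -> even_smooth 2 v -> (forall r, 0 <= r < 1 -> 0 < W r) ->
  (forall r, W (clamp01 r) <= kap) ->
  classical_solution lam (fun x : 'rV[R]_N => W (enorm x)).
Proof.
move=> N0 kap1 RS S4 S2 pos Wkap.
have [[Wc ac vc cc] W1 a1 dW1 S] := RS.
have clampE r : 0 <= r <= 1 -> clamp01 r = r.
  by move=> /andP[r0 r1]; rewrite /clamp01 max_l// min_l.
have lt1 r : 0 <= r <= 1 -> W r < 1.
  by move=> r01; apply: le_lt_trans kap1; rewrite -(clampE r r01).
have SW2 : even_smooth 2 W by do 2 apply: even_smoothW.
have lapE x : uball x -> laplacian (fun y => W (enorm y)) x = v (enorm x).
  apply: (laplacian_lift (a := a)) => // r r01; by have [] := S r r01.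
have fc : continuous (mems_rhs lam (W \o @clamp01 R)).
  apply: mems_rhs_continuous => r; last by rewrite /=; apply: le_lt_trans kap1.
  apply: (@continuous_comp _ _ _ (@clamp01 R) W); last exact: Wc.
  by apply: (lipschitz_continuous (M := 1)) => {}r s; rewrite mul1r; exact: clamp01_lip.
have cont F : continuous F -> continuous (fun x : 'rV[R]_N => F (enorm x) : R).
  move=> Fc x; apply: (@continuous_comp _ _ _ enorm F); last exact: Fc.
  exact: enorm_continuous.
split.
- split; first by apply: CK_Ck_ball; exact: (CK_lift S4).
  split; first by apply: CK_Ck_ball; do 3 apply: CKW; exact: (CK_lift S4).
    by apply: continuous_subspaceT; exact: cont.
  move=> i; exists (fun x => x 0 i * a (enorm x)).
    apply: continuous_subspaceT => x; apply: continuousM; first exact: coord_continuous.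
    exact: cont.
  have dW r (r01 : 0 < r < 1) : is_derive r 1 W (r * a r) by have [] := S r r01.
  by move=> x bx; have [_] := is_derive_lift i Wc ac dW bx; rewrite /partial => ->.
- move=> x bx; rewrite /bilaplacian (laplacian_ext bx lapE).
  have dv r (r01 : 0 < r < 1) : is_derive r 1 v (r * c r) by have [] := S r r01.
  have dc r (r01 : 0 < r < 1) : is_derive r 1 c _ := let: And4 _ _ _ h := S r r01 in h.
  rewrite (laplacian_lift S2 fc dv dc bx).
  by rewrite /mems_rhs /= clampE// enorm_ge0/= ltW.
- move=> x bx; rewrite pos ?enorm_ge0//= lt1// enorm_ge0/=; exact: ltW.
- move=> x sx; rewrite sx; split=> //; rewrite /has_normal_derivative.
  have := slope_at1_derive W1 dW1 => sl.
  apply: (cvg_near _ sl); near=> h.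
  have h1 : 0 < 1 + h.
    by rewrite -ltrBlDl sub0r; near: h; apply: nbhs_left_gt; rewrite oppr_lt0.
  have -> : x + h *: x = (1 + h) *: x by rewrite scalerDl scale1r.
  by rewrite enormZ sx mulr1 (gtr0_norm h1) W1 subr0 mulrC.
Unshelve. all: by end_near. Qed.

Lemma barrier_const_gt0 : (9 <= N)%N -> 0 < barrier_const N :> R.
Proof.
move=> N9; have n9 : (9 : R) <= N%:R by rewrite (ler_nat _ 9).
by rewrite /barrier_const !mulr_gt0//; lra.
Qed.

(** The Hardy-Rellich condition for the linearization at the barrier. This is where
the dimension enters: the inequality fails for [N = 8]. As a polynomial in
[N - 9], the difference of the two sides has positive coefficients. *)
Lemma barrier_const_stable : (9 <= N)%N ->
  16 * (2 * barrier_const N) <= N%:R ^+ 2 * (N%:R - 4) ^+ 2 :> R.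
Proof.
move=> N9; have n9 : (0 : R) <= N%:R - 9 by rewrite subr_ge0 (ler_nat _ 9).
have h2 := exprn_ge0 2 n9; have h3 := exprn_ge0 3 n9; have h4 := exprn_ge0 4 n9.
rewrite /barrier_const; lra.
Qed.

Lemma barrier_powers r : 0 < r -> let p := r `^ (4 / 3) in
  [/\ 0 < p, r ^+ 4 = p ^+ 3 & r `^ (- (8 / 3)) = (p ^+ 2)^-1].
Proof.
move=> r0 p; split; first exact: powR_gt0.
- rewrite -!powR_mulrn ?powR_ge0 ?ltW// /p -powRrM; congr (_ `^ _); by field.
- rewrite powRN; congr (_^-1); rewrite -powR_mulrn ?powR_ge0// /p -powRrM.
  congr (_ `^ _); by field.
Qed.

(** For [lam >= barrier_const] the barrier is a singular subsolution. With [p = 1 - barrier] and [b = 1 - u], convexity of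
[t |-> 1 / t^2] gives
[barrier_const / p^2 - lam / b^2 <= 2 barrier_const (b - p) / p^3],
and [p^3 = r^4]: the difference [b - p = barrier - u] satisfies the hypothesis of
[hardy_rellich_comparison]. *)
Lemma le_barrier_of_large lam u : (9 <= N)%N -> barrier_const N <= lam ->
  classical_solution lam u -> radial_on_ball u ->
  forall x, uball x -> 0 < enorm x -> u x <= barrier (enorm x).
Proof.
move=> N9 lamb uS ru x bx x0.
have N0 : (0 < N)%N by exact: leq_trans N9.
have N4 : (4 < N)%N by exact: leq_trans N9.
pose i0 := Ordinal N0.
have [S T sl _] := classical_profile i0 uS ru.
rewrite (radial_ray i0 ru bx) -subr_ge0.
have b0 := barrier_const_gt0 N9.
apply: (hardy_rellich_comparison N4 (k := 2 * barrier_const N) _ (barrier_const_stable N9)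
  (radial_systemB (barrier_system N) S) (tame_at0B (barrier_tame N) T)
  (slope_at1B barrier_slope sl)); last by rewrite x0.
  by rewrite mulr_gt0.
move=> r /andP[r0 r1]; have [p0 -> ->] := barrier_powers r0.
have br : uball (on_ray i0 r) by apply/uball_ray; rewrite gtr0_norm.
have [_ _ u01 _] := uS; have /andP[_ u1] := u01 _ br.
rewrite /mems_rhs /barrier; set p := r `^ (4 / 3) in p0 *.
set b := 1 - u (on_ray i0 r); have bp : 0 < b by rewrite subr_gt0.
have -> : 1 - p - u (on_ray i0 r) = b - p by rewrite /b; ring.
apply: (@le_trans _ _ (barrier_const N * (p - p ^+ 3 / b ^+ 2))).
  have -> : p ^+ 3 * (barrier_const N / p ^+ 2 - lam / b ^+ 2) =
     barrier_const N * p - lam * (p ^+ 3 / b ^+ 2).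
    by field; rewrite !gt_eqF.
  rewrite mulrBr lerB// ler_wpM2r//.
  by rewrite divr_ge0 ?exprn_ge0// ltW.
have -> : 2 * barrier_const N * (b - p) = barrier_const N * (2 * (b - p)) by ring.
rewrite ler_pM2l// -subr_ge0.
have -> : 2 * (b - p) - (p - p ^+ 3 / b ^+ 2) = (b - p) ^+ 2 * (2 * b + p) / b ^+ 2.
  by field; rewrite gt_eqF.
by rewrite divr_ge0 ?sqr_ge0// mulr_ge0 ?sqr_ge0// addr_ge0 ?mulr_ge0// ltW.
Qed.

(** For [lam <= barrier_const] the barrier is a supersolution, and so is [u] itself.
[exists_solution_below] provides a classical solution below the barrier, and the
minimal solution [u] is below that one. The bound [u 0 < 1] for the values of [u] comes from
its monotonicity along rays. *)
Lemma le_barrier_of_small lam u : (9 <= N)%N -> 0 < lam -> lam <= barrier_const N ->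
  minimal_solution lam u ->
  forall x, uball x -> 0 < enorm x -> u x <= barrier (enorm x).
Proof.
move=> N9 lam0 lamb um x bx x0.
have N0 : (0 < N)%N by exact: leq_trans N9.
have N4 : (4 < N)%N by exact: leq_trans N9.
have ru := minimal_solution_radial um; have [uS umin] := um.
pose i0 := Ordinal N0.
have [S T sl u0] := classical_profile i0 uS ru.
have [_ _ u01 _] := uS.
have bray r : 0 < r < 1 -> uball (on_ray i0 r).
  by move=> /andP[r0 r1]; apply/uball_ray; rewrite gtr0_norm.
have superU : supersolution N lam (fun r => u (on_ray i0 r)).
  do 5 eexists; split; [exact: S|exact: T|by split; [exact: sl|]| |by []].
  by move=> r /bray/u01 /andP[].
have superB : supersolution N lam (@barrier R).
  do 5 eexists; split; [exact: barrier_system|exact: barrier_tame| | |].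
    by split; [exact: barrier_slope|lra].
    by move=> r /andP[r0 _]; rewrite /barrier gtrBl powR_gt0.
  move=> r /andP[r0 _]; have [p0 _ ->] := barrier_powers r0.
  by rewrite /mems_rhs /barrier subKr; apply: ler_wpM2r => //; rewrite invr_ge0 sqr_ge0.
have b0 : uball (0 : 'rV[R]_N) by rewrite /uball /= enorm0.
have /andP[_ u01'] := u01 _ b0.
have Ule r : 0 < r < 1 -> u (on_ray i0 r) <= u 0.
  move=> /andP[r0 r1]; apply: (le_at_right0 u0 r0) => s /andP[s0 sr].
  apply: (derive_le0_homo (f := fun r => u (on_ray i0 r))
    (df := fun r => r * (partial i0 u (on_ray i0 r) / r)) (a := 0) (b := 1)) => //.
  - by move=> z z01; have [] := S z z01.
  - move=> z /[dup] z01 /andP[z0 z1].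
    have [] := radial_boggio N4 (lexx 0) S T sl _ z01.
      by move=> t t01; rewrite divr_ge0 ?sqr_ge0// ltW.
    by move=> h _; rewrite mulr_ge0_le0// ltW.
  - exact: ltW.
have [W [a [v [c [RS [S4 S2] Wpos Wkap Wle]]]]] :=
  exists_solution_below N4 lam0 u01' superU superB Ule.
have wS : classical_solution lam (fun x : 'rV[R]_N => W (enorm x)).
  exact: (lift_classical_solution N0 u01' RS).
apply: le_trans (umin _ wS x bx) _.
by have [] := Wle (enorm x); first by rewrite x0.
Qed.

End Solutions.

Theorem lemma4p1 (R : realType) (N : nat) (hN : (9 <= N)%N)
  (hlam : (0 < lambda_star R N < +oo)%E)
  (ustar : 'rV[R]_N -> R) (hustar : extremal_solution ustar) :
  forall x : 'rV[R]_N, uball x -> ustar x <= 1 - enorm x `^ (4 / 3).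
Proof.
move=> x bx; have [u [umin ulim]] := hustar.
have /andP[ls0 lsy] := hlam.
have lsE : (fine (lambda_star R N))%:E = lambda_star R N.
  by rewrite fineK// ge0_fin_numE// ltW.
have le_u lam : 0 < lam -> lam < fine (lambda_star R N) ->
    u lam x <= 1 - enorm x `^ (4 / 3).
  move=> lam0 lam_lt; have um : minimal_solution lam (u lam).
    by apply: umin => //; rewrite -lsE lte_fin.
  have [x0|x0] := eqVneq (enorm x) 0.
    rewrite x0 powR0 ?subr0; last by rewrite gt_eqF.
    by have [[_ _ u01 _] _] := um; have /andP[_ /ltW] := u01 x bx.
  have x_gt0 : 0 < enorm x by rewrite lt_neqAle eq_sym x0 enorm_ge0.
  have [lamb|/ltW lamb] := leP (barrier_const N) lam.
    have [uS _] := um.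
    exact: (le_barrier_of_large hN lamb uS (minimal_solution_radial um) bx x_gt0).
  exact: (le_barrier_of_small hN lam0 lamb um bx x_gt0).
have := ulim x bx => lim_u; rewrite -(cvg_lim _ lim_u)//.
apply: limr_le; first by apply/cvg_ex; exists (ustar x).
near=> lam; apply: le_u; near: lam.
  apply: nbhs_left_gt; by rewrite -lte_fin lsE.
exact: nbhs_left_lt.
Unshelve. all: by end_near. Qed.
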